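(* (Quaternionic Furuta inequality) Let $\mathsf{H}$ be a right quaternionic Hilbert space, let $A, B\in \mathfrak{B}(\mathsf{H})$ with $A\geq B\geq 0$, and let $r\geq 0$. If $p\geq 0$ and $q\geq 1$ are real numbers such that $(1+2r)q \geq p+2r$, then $$(B^rA^pB^r)^{\frac{1}{q}}\geq B^{\frac{p+2r}{q}}$$ and $$A^{\frac{p+2r}{q}}\geq (A^rB^pA^r)^{\frac{1}{q}}.$$
   Context: $\mathbb{H}$ is the skew field of quaternions. A right quaternionic Hilbert space $\mathsf{H}$ is a right vector space over $\mathbb{H}$ with an inner product $\langle\cdot,\cdot\rangle:\mathsf{H}\times\mathsf{H}\to\mathbb{H}$ satisfying $\overline{\langle u,v\rangle}=\langle v,u\rangle$, $\langle u,u\rangle>0$ for $u\neq 0$, and $\langle u,vp+wq\rangle=\langle u,v\rangle p+\langle u,w\rangle q$ for $u,v,w\in\mathsf{H}$, $p,q\in\mathbb{H}$, complete in the norm $\|u\|=\sqrt{\langle u,u\rangle}$. $\mathfrak{B}(\mathsf{H})$ is the set of bounded right linear operators $T:\mathsf{H}\to\mathsf{H}$, i.e. $T(up+v)=(Tu)p+Tv$. Adjoint and selfadjoint are defined as in the complex case. $T\ge 0$ (positive) means $\langle Tx,x\rangle\geq 0$ for all $x\in\mathsf{H}$ (positive operators are selfadjoint), and $S\leq T$ means $T-S\geq 0$. The spherical spectrum $\sigma_S(T)$ is the set of $q\in\mathbb{H}$ for which $\Delta_q(T):=T^2-T(q+\bar q)+I|q|^2$ has no inverse in $\mathfrak{B}(\mathsf{H})$;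 for $T\ge0$ it is contained in $[0,+\infty)$. For $T\geq 0$ and $t\geq 0$, the power $T^t$ is $f(T)$ with $f(s)=s^t$ on $\sigma_S(T)$, in the quaternionic continuous functional calculus $\mathcal{C}(\sigma_S(T),\mathbb{R})\to\mathfrak{B}(\mathsf{H})$ (the continuous unital homomorphism of real Banach algebras sending the identity function to $T$; its values are selfadjoint and it is positivity preserving). In particular $T^0=I$. *)

(* Defs.v *)
From HB Require Import structures.
From mathcomp Require Import all_boot all_order all_algebra.
From mathcomp Require Import ring.
From mathcomp Require Import boolp classical_sets reals.
From mathcomp Require Import topology normedtype exp.

Set Implicit Arguments.
Unset Strict Implicit.
Unset Printing Implicit Defensive.

Import Order.TTheory GRing.Theory Num.Theory.
Import numFieldNormedType.Exports.
Local Open Scope classical_set_scope.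
Local Open Scope ring_scope.

(* [Quat a b c d] is the quaternion a + b i + c j + d k. *)
Record quat (R : Type) := Quat { qre : R; qi : R; qj : R; qk : R }.

Section QuaternionChoice.
Variable R : choiceType.

Definition quat_tuple (x : quat R) := (qre x, qi x, qj x, qk x).
Definition tuple_quat (t : R * R * R * R) :=
  let: (a, b, c, d) := t in Quat a b c d.

Lemma quat_tupleK : cancel quat_tuple tuple_quat.
Proof. by case. Qed.

HB.instance Definition _ := Choice.copy (quat R) (can_type quat_tupleK).

End QuaternionChoice.

Section QuaternionRing.
Variable R : realType.
Implicit Types x y z : quat R.

Definition real_quat (a : R) : quat R := Quat a 0 0 0.

Definition quat_add x y :=
  Quat (qre x + qre y) (qi x + qi y) (qj x + qj y) (qk x + qk y).
Definition quat_opp x := Quat (- qre x) (- qi x) (- qj x) (- qk x).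
Definition quat_mul x y :=
  Quat (qre x * qre y - qi x * qi y - qj x * qj y - qk x * qk y)
       (qre x * qi y + qi x * qre y + qj x * qk y - qk x * qj y)
       (qre x * qj y - qi x * qk y + qj x * qre y + qk x * qi y)
       (qre x * qk y + qi x * qj y - qj x * qi y + qk x * qre y).

Fact quat_addA : associative quat_add.
Proof. by case=> ? ? ? ? [? ? ? ?] [? ? ? ?]; rewrite /quat_add /= !addrA. Qed.
Fact quat_addC : commutative quat_add.
Proof. by case=> a b c d [e f g h]; congr Quat; rewrite /= addrC. Qed.
Fact quat_add0 : left_id (real_quat 0) quat_add.
Proof. by case=> a b c d; congr Quat; rewrite /= add0r. Qed.
Fact quat_addN : left_inverse (real_quat 0) quat_opp quat_add.
Proof. by case=> a b c d; congr Quat; rewrite /= addNr. Qed.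

HB.instance Definition _ :=
  GRing.isZmodule.Build (quat R) quat_addA quat_addC quat_add0 quat_addN.

Fact quat_mulA : associative quat_mul.
Proof. by case=> ? ? ? ? [? ? ? ?] [? ? ? ?]; congr Quat; rewrite /=; ring. Qed.
Fact quat_1mul : left_id (real_quat 1) quat_mul.
Proof. by case=> ? ? ? ?; congr Quat; rewrite /=; ring. Qed.
Fact quat_mul1 : right_id (real_quat 1) quat_mul.
Proof. by case=> ? ? ? ?; congr Quat; rewrite /=; ring. Qed.
Fact quat_mulDl : left_distributive quat_mul quat_add.
Proof. by case=> ? ? ? ? [? ? ? ?] [? ? ? ?]; congr Quat; rewrite /=; ring. Qed.
Fact quat_mulDr : right_distributive quat_mul quat_add.
Proof. by case=> ? ? ? ? [? ? ? ?] [? ? ? ?]; congr Quat; rewrite /=; ring. Qed.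
Fact quat_1_neq0 : real_quat 1 != 0.
Proof. by apply/eqP => -[/eqP]; rewrite oner_eq0. Qed.

HB.instance Definition _ := GRing.Zmodule_isNzRing.Build (quat R)
  quat_mulA quat_1mul quat_mul1 quat_mulDl quat_mulDr quat_1_neq0.

Definition conjq x := Quat (qre x) (- qi x) (- qj x) (- qk x).

(* |x|^2 *)
Definition normq2 x : R := qre x ^+ 2 + qi x ^+ 2 + qj x ^+ 2 + qk x ^+ 2.

(* x > 0 and x >= 0 include the assertion that x is real. *)
Definition qpos x := exists2 a : R, 0 < a & x = real_quat a.
Definition qnneg x := exists2 a : R, 0 <= a & x = real_quat a.

End QuaternionRing.

(* A right module over a ring is a left module over the converse ring; the
   scaling [p *: u] of such a module is the right scaling u p. *)
Definition rscale (R : realType) (V : lmodType (quat R)^c) (u : V)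
  (p : quat R) : V := (p : (quat R)^c) *: u.
Infix "*>" := rscale (at level 40, left associativity) : ring_scope.

HB.mixin Record isRightQuaternionicHilbert (R : realType) V
    of GRing.Lmodule (quat R)^c V := {
  qdot : V -> V -> quat R ;
  conj_qdot : forall u v : V, conjq (qdot u v) = qdot v u ;
  qdot_gt0 : forall u : V, u != 0 -> qpos (qdot u u) ;
  qdot_linearr : forall (u v w : V) (p q : quat R),
    qdot u (v *> p + w *> q) = qdot u v * p + qdot u w * q ;
  (* completeness for the norm sqrt <u, u> *)
  qhilbert_complete : forall x : nat -> V,
    (forall e : R, 0 < e -> exists N : nat, forall m n : nat,
      (N <= m)%N -> (N <= n)%N ->
      Num.sqrt (qre (qdot (x m - x n) (x m - x n))) < e) ->
    exists l : V, forall e : R, 0 < e -> exists N : nat, forall n : nat,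
      (N <= n)%N -> Num.sqrt (qre (qdot (x n - l) (x n - l))) < e
}.

#[short(type="qhilbertType")]
HB.structure Definition RightQuaternionicHilbert (R : realType) :=
  { V of GRing.Lmodule (quat R)^c V & isRightQuaternionicHilbert R V }.

Section Operators.
Variables (R : realType) (H : qhilbertType R).
Implicit Types S T : H -> H.

Definition qnorm (u : H) : R := Num.sqrt (qre (qdot u u)).

(* The set B(H); its elements are kept as plain functions. *)
Definition bounded_op : set (H -> H) := [set T |
  (forall (u v : H) (p : quat R), T (u *> p + v) = T u *> p + T v) /\
  (exists C : R, forall u : H, qnorm (T u) <= C * qnorm u)].

Definition op_ge0 T := forall x : H, qnneg (qdot (T x) x).
Definition op_le S T := op_ge0 (T \- S).

(* The scalars of [Delta] are real, so T a is the operator x |-> (T x) a. *)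
Definition op_scale T (a : quat R) : H -> H := fun x => T x *> a.

Definition Delta (T : H -> H) (q : quat R) : H -> H :=
  ((T \o T) \- op_scale T (q + conjq q)) \+ op_scale idfun (real_quat (normq2 q)).

Definition op_invertible T :=
  exists2 S, bounded_op S & cancel T S /\ cancel S T.

Definition sspectrum T : set (quat R) := [set q | ~ op_invertible (Delta T q)].

(* For T >= 0 the spherical spectrum lies in [0, +oo), so that nothing is lost
   by viewing it as a set of real numbers. *)
Definition rspectrum T : set R := [set s | sspectrum T (real_quat s)].

(* C(sigma_S(T), R): real functions whose restriction to the spectrum is
   continuous; the values off the spectrum play no role (see [cfc_ext]). *)
Definition spectral_cont T : set (R -> R) :=
  [set f | {within rspectrum T, continuous f}].

(* [Phi] is the continuous functional calculus of T: a continuous unital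
   homomorphism of real algebras from C(sigma_S(T), R), with the sup norm, to
   B(H), with the operator norm, mapping the identity function to T. *)
Record is_cfc T (Phi : (R -> R) -> (H -> H)) : Prop := IsCfc {
  cfc_bounded : forall f, spectral_cont T f -> bounded_op (Phi f) ;
  cfc_ext : forall f g, spectral_cont T f -> spectral_cont T g ->
    (forall s, rspectrum T s -> f s = g s) -> Phi f = Phi g ;
  cfc_unit : Phi (fun=> 1) = idfun ;
  cfc_add : forall f g, spectral_cont T f -> spectral_cont T g ->
    Phi (f \+ g) = Phi f \+ Phi g ;
  cfc_scale : forall (a : R) f, spectral_cont T f ->
    Phi (fun s => a * f s) = op_scale (Phi f) (real_quat a) ;
  cfc_mul : forall f g, spectral_cont T f -> spectral_cont T g ->
    Phi (f \* g) = Phi f \o Phi g ;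
  cfc_id : Phi idfun = T ;
  cfc_continuous : forall f, spectral_cont T f -> forall e : R, 0 < e ->
    exists2 d : R, 0 < d & forall g, spectral_cont T g ->
      (forall s, rspectrum T s -> `|g s - f s| <= d) ->
      forall x : H, qnorm (Phi g x - Phi f x) <= e * qnorm x
}.

(* The functional calculus of T, picked by classical choice (with a junk value
   in case there is none). *)
Definition cfc T : (R -> R) -> (H -> H) :=
  xget (fun _ _ => 0) [set Phi | is_cfc T Phi].

(* T^t, for T >= 0 and t >= 0. Note that powR 0 0 = 1, whence T^0 = I. *)
Definition op_pow T (t : R) : H -> H := cfc T (fun s => powR s t).

End Operators.

Notation "T `^^ t" := (op_pow T t)
  (at level 11, right associativity) : ring_scope.

(* Main.v *)
(** The right quaternionic Hilbert space H is treated as a real Hilbert space for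
    [Re <u, v>]: a bounded operator is positive exactly when it is symmetric and
    nonnegative for this real form.

    Functional calculus. If p is a real polynomial that is nonnegative on the
    spectrum of a symmetric T, then p(T) >= 0: with m the largest real such that
    p(T) >= m, the polynomial p - m must have a root in the spectrum, since
    otherwise, by the factorization of real polynomials, p(T) - m >= 0 would be
    bounded below.  Hence |p(T)| <= sup |p| over the spectrum, and f(T) is the
    norm limit of p(T) as p tends to f (Weierstrass and Tietze).

    Loewner-Heinz. Let e <= Y <= X.  If Y^a <= c X^a and Y^b <= X^b, then
    Y^((a+b)/2) <= sqrt c X^((a+b)/2), because X^(-(a+b)/4) Y^((a+b)/2)
    X^(-(a+b)/4) is selfadjoint and similar to an operator of norm at most
    sqrt c.  Since Y^t <= c X^t for all t in [0, 1] with some fixed c, halving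
    [c - 1] repeatedly gives c = 1; the general case follows by adding e > 0.

    Furuta. The case p <= 1 is Loewner-Heinz. Let p >= 1 and r <= 1/2, let
    q = (p + 2r)/(1 + 2r), a = 1 - 1/q and C = A^(p/2) B^r, with adjoint D.
    Formally (D C)^(1/q) = D (C D)^(-a) C >= D (A^(p+2r))^(-a) C = B^r A B^r
    >= B^(1+2r), because C D = A^(p/2) B^(2r) A^(p/2) <= A^(p+2r) and s^(-a) is
    operator antitone; replacing s^(-a) by 1/(s^a + d) and letting d tend to 0
    avoids inverses.  Applying this again to (D C)^(1/q) >= B^(1+2r) with
    r = 1/2 doubles 1 + 2r, which reaches every r; a larger q is reached by
    Loewner-Heinz.  The second inequality is proved in the same way. *)
Require Import Defs.
From HB Require Import structures.
From mathcomp Require Import all_boot all_order all_algebra.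
From mathcomp Require Import ring lra complex.
From mathcomp Require Import boolp classical_sets reals.
From mathcomp Require Import topology normedtype sequences derive exp numfun.
Set Implicit Arguments.
Unset Strict Implicit.
Unset Printing Implicit Defensive.
Import Order.TTheory GRing.Theory Num.Theory.
Import numFieldNormedType.Exports.
Local Open Scope classical_set_scope.
Local Open Scope ring_scope.

(** * The real inner product *)

Section RealInnerProduct.
Variables (R : realType) (H : qhilbertType R).
Implicit Types (u v w x y : H) (p q : quat R) (a : R).

Definition rdot u v : R := qre (qdot u v).

Lemma rscaleDr u v p : (u + v) *> p = u *> p + v *> p.
Proof. exact: scalerDr. Qed.

Lemma rscaleA u p q : u *> p *> q = u *> (p * q).
Proof. exact: scalerA. Qed.

Lemma rscale1 u : u *> real_quat 1 = u.
Proof. exact: scale1r. Qed.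

Lemma rscaleDl u p q : u *> (p + q) = u *> p + u *> q.
Proof. exact: scalerDl. Qed.

Lemma rscaleN1 u : u *> real_quat (-1) = - u.
Proof.
rewrite -[in RHS](rscale1 u) -[in LHS]/(real_quat (-1)).
rewrite -scaleNr; congr (_ *: _).
by apply: (congr1 (fun t => Quat (-1) t t t)); rewrite oppr0.
Qed.

Lemma qdotDr u v w : qdot u (v + w) = qdot u v + qdot u w.
Proof. by have := qdot_linearr u v w 1 1; rewrite !mulr1 !rscale1. Qed.

Lemma qdot0r u : qdot u 0 = 0.
Proof. by apply: (addIr (qdot u 0)); rewrite -qdotDr !add0r. Qed.

Lemma qdotZr u v p : qdot u (v *> p) = qdot u v * p.
Proof.
have := qdot_linearr u v 0 p 1.
by rewrite rscale1 qdot0r mul0r !addr0.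
Qed.

Lemma rdotC u v : rdot u v = rdot v u.
Proof. by rewrite /rdot -conj_qdot. Qed.

Lemma rdotDr u v w : rdot u (v + w) = rdot u v + rdot u w.
Proof. by rewrite /rdot qdotDr. Qed.

Lemma rdotDl u v w : rdot (v + w) u = rdot v u + rdot w u.
Proof. by rewrite rdotC rdotDr !(rdotC u). Qed.

Lemma rdotZr u v a : rdot u (v *> real_quat a) = a * rdot u v.
Proof. by rewrite /rdot qdotZr /= !mulr0 !subr0 mulrC. Qed.

Lemma rdotZl u v a : rdot (v *> real_quat a) u = a * rdot v u.
Proof. by rewrite rdotC rdotZr rdotC. Qed.

Lemma rdotNr u v : rdot u (- v) = - rdot u v.
Proof. by rewrite -rscaleN1 rdotZr mulN1r. Qed.

Lemma rdotNl u v : rdot (- v) u = - rdot v u.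
Proof. by rewrite rdotC rdotNr rdotC. Qed.

Lemma rdotBr u v w : rdot u (v - w) = rdot u v - rdot u w.
Proof. by rewrite rdotDr rdotNr. Qed.

Lemma rdot0r u : rdot u 0 = 0.
Proof. by rewrite -(subrr 0) rdotBr subrr. Qed.

Lemma rdot0l u : rdot 0 u = 0.
Proof. by rewrite rdotC rdot0r. Qed.

Lemma rdot_ge0 u : 0 <= rdot u u.
Proof.
have [->|/qdot_gt0[a a0 E]] := eqVneq u 0; first by rewrite rdot0l.
by rewrite /rdot E /= ltW.
Qed.

Lemma rdot_eq0 u : rdot u u = 0 -> u = 0.
Proof.
have [->//|/qdot_gt0[a a0 E]] := eqVneq u 0.
by rewrite /rdot E /= => a_eq0; rewrite a_eq0 ltxx in a0.
Qed.

Lemma sqr_qnorm u : qnorm u ^+ 2 = rdot u u.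
Proof. by rewrite sqr_sqrtr ?rdot_ge0. Qed.

Lemma qnorm_ge0 u : 0 <= qnorm u.
Proof. exact: sqrtr_ge0. Qed.

Lemma qnorm_le u c : 0 <= c -> rdot u u <= c ^+ 2 -> qnorm u <= c.
Proof. by move=> c0; rewrite -sqr_qnorm ler_sqr ?nnegrE ?qnorm_ge0. Qed.

Lemma qnorm_eq0 u : qnorm u = 0 -> u = 0.
Proof. by move=> E; apply: rdot_eq0; rewrite -sqr_qnorm E expr0n. Qed.

Lemma qnorm0 : qnorm (0 : H) = 0.
Proof. by rewrite /qnorm -/(rdot 0 0) rdot0l sqrtr0. Qed.

(* The discriminant of [t |-> a + 2 t b + t^2 c >= 0]. *)
Lemma discr_le (a b c : R) : 0 <= c ->
  (forall t, 0 <= a + 2 * t * b + t ^+ 2 * c) -> b ^+ 2 <= a * c.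
Proof.
move=> c0 h.
have [c_eq0|c_neq0] := eqVneq c 0.
  (* With c = 0 the expression is affine in t, and for b nonzero it equals -1 at this t. *)
  have := h (- (a + 1) / (2 * b)); have [->|b0] := eqVneq b 0.
    by move=> _; rewrite c_eq0 mulr0 expr0n.
  rewrite c_eq0; have -> : a + 2 * (- (a + 1) / (2 * b)) * b +
    (- (a + 1) / (2 * b)) ^+ 2 * 0 = -1 by field.
  by rewrite lerNr oppr0 ler10.
have c_gt0 : 0 < c by rewrite lt_def c_neq0.
have := h (- b / c).
have -> : a + 2 * (- b / c) * b + (- b / c) ^+ 2 * c = (a * c - b ^+ 2) / c.
  by field.
by rewrite pmulr_lge0 ?invr_gt0 // subr_ge0.
Qed.

(** Cauchy-Schwarz, from the discriminant of t -> |u + t v|^2. *)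
Lemma rdot_le u v : rdot u v <= qnorm u * qnorm v.
Proof.
have h : rdot u v ^+ 2 <= rdot u u * rdot v v.
  apply: discr_le => [|t]; first exact: rdot_ge0.
  have := rdot_ge0 (u + v *> real_quat t).
  rewrite !(rdotDl, rdotDr) !(rdotZl, rdotZr) (rdotC v u).
  by congr (_ <= _); ring.
rewrite -!sqr_qnorm -exprMn in h.
apply: le_trans (ler_norm _) _; rewrite -ler_sqr ?nnegrE ?mulr_ge0 ?qnorm_ge0 //.
by rewrite real_normK ?num_real.
Qed.

Lemma qnormD u v : qnorm (u + v) <= qnorm u + qnorm v.
Proof.
apply: qnorm_le; first by rewrite addr_ge0 ?qnorm_ge0.
rewrite rdotDl !rdotDr sqrrD !sqr_qnorm (rdotC v u).
have := rdot_le u v; lra.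
Qed.

Lemma qnormZ u p : qnorm (u *> p) = Num.sqrt (normq2 p) * qnorm u.
Proof.
have [->|/qdot_gt0[a a0 E]] := eqVneq u 0.
  by rewrite /rscale scaler0 qnorm0 mulr0.
rewrite /qnorm -sqrtrM; last by rewrite /normq2 !addr_ge0 // sqr_ge0.
congr Num.sqrt.
rewrite qdotZr -conj_qdot qdotZr E /= /normq2; ring.
Qed.

Lemma qnormZr u a : qnorm (u *> real_quat a) = `|a| * qnorm u.
Proof.
by rewrite qnormZ /normq2 /= !expr0n /= !addr0 sqrtr_sqr.
Qed.

Lemma qnormN u : qnorm (- u) = qnorm u.
Proof. by rewrite -rscaleN1 qnormZr normrN1 mul1r. Qed.

Lemma qnorm_small u (c : R) :
  (forall e, 0 < e -> qnorm u <= e * c) -> u = 0.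
Proof.
move=> h; apply: qnorm_eq0; apply: le_anti; rewrite qnorm_ge0 andbT.
have c1 : 0 < `|c| + 1 by rewrite ltr_wpDl.
apply/ler_addgt0Pr => e e0; rewrite add0r.
have := h (e / (`|c| + 1)); rewrite divr_gt0 // => /(_ isT) h'.
apply: le_trans h' _; rewrite mulrAC ler_pdivrMr // ler_pM2l //.
by rewrite (le_trans (ler_norm _)) // lerDl.
Qed.

Lemma qnormDN u v : qnorm u - qnorm v <= qnorm (u - v).
Proof. by have := qnormD (u - v) v; rewrite subrK; lra. Qed.

End RealInnerProduct.

(** * The algebra of bounded operators *)

(* Only a [pzRingType]: the identity and zero operators of the zero space
   coincide. *)
Record bop (R : realType) (H : qhilbertType R) :=
  Bop { bop_fun :> H -> H; bop_fun_bounded : bounded_op bop_fun }.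

Section BoundedOperators.
Variables (R : realType) (H : qhilbertType R).
Implicit Types (S T U : bop H) (u v x y : H) (p : quat R) (a c : R).

Lemma bop_ext S T : (forall x, S x = T x) -> S = T.
Proof.
case: S T => [S bS] [T bT] /= /funext E; move: bS; rewrite E => bS.
by congr Bop; exact: Prop_irrelevance.
Qed.

HB.instance Definition _ := gen_eqMixin (bop H).
HB.instance Definition _ := gen_choiceMixin (bop H).

Lemma bopD T u v : T (u + v) = T u + T v.
Proof.
by have [+ _] := bop_fun_bounded T => /(_ u v 1); rewrite !rscale1.
Qed.

Lemma bop0 T : T 0 = 0.
Proof. by apply: (addIr (T 0)); rewrite -bopD !add0r. Qed.

Lemma bopZ T u p : T (u *> p) = T u *> p.
Proof.
by have [+ _] := bop_fun_bounded T => /(_ u 0 p); rewrite bop0 !addr0.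
Qed.

Lemma bopN T u : T (- u) = - T u.
Proof. by rewrite -!rscaleN1 bopZ. Qed.

Lemma bopB T u v : T (u - v) = T u - T v.
Proof. by rewrite bopD bopN. Qed.

Lemma bop_bound T : exists2 c, 0 < c & forall u, qnorm (T u) <= c * qnorm u.
Proof.
have [_ [c hc]] := bop_fun_bounded T; exists (`|c| + 1) => [|u].
  by rewrite ltr_wpDl.
apply: le_trans (hc u) _; rewrite ler_wpM2r ?qnorm_ge0 //.
by rewrite (le_trans (ler_norm _)) // lerDl.
Qed.

Fact bop_zero_bounded : bounded_op (fun _ : H => 0).
Proof.
split=> [u v p|]; first by rewrite /rscale scaler0 addr0.
by exists 0 => u; rewrite qnorm0 mul0r.
Qed.

Fact bop_one_bounded : bounded_op (@idfun H).
Proof. by split=> //; exists 1 => u; rewrite mul1r. Qed.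

Fact bop_add_bounded S T : bounded_op (S \+ T).
Proof.
split=> [u v p|]; first by rewrite /= !bopD !bopZ rscaleDr addrACA.
have [[c _ hc] [d _ hd]] := (bop_bound S, bop_bound T).
exists (c + d) => u; apply: le_trans (qnormD _ _) _.
by rewrite mulrDl lerD.
Qed.

Fact bop_opp_bounded T : bounded_op (fun x => - T x).
Proof.
split=> [u v p|]; first by rewrite bopD bopZ opprD /rscale scalerN.
by have [c _ hc] := bop_bound T; exists c => u; rewrite qnormN.
Qed.

Fact bop_mul_bounded S T : bounded_op (S \o T).
Proof.
split=> [u v p|]; first by rewrite /= !bopD !bopZ.
have [[c c0 hc] [d _ hd]] := (bop_bound S, bop_bound T).
exists (c * d) => u; apply: le_trans (hc _) _.
by rewrite -mulrA ler_pM2l.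
Qed.

(** Centrality of the reals makes scaling by them preserve right linearity, so that [bop H] becomes
    a real module. *)
Lemma real_quatC a p : real_quat a * p = p * real_quat a.
Proof.
case: p => w i j k; rewrite -[LHS]/(quat_mul _ _) -[RHS]/(quat_mul _ _).
by rewrite /quat_mul /=; congr Quat; ring.
Qed.

Fact bop_scale_bounded a T : bounded_op (op_scale T (real_quat a)).
Proof.
split=> [u v p|].
  by rewrite /op_scale bopD bopZ rscaleDr !rscaleA real_quatC.
have [c c0 hc] := bop_bound T; exists (`|a| * c) => u.
by rewrite /op_scale qnormZr -mulrA ler_wpM2l.
Qed.

Definition bop_zero : bop H := Bop bop_zero_bounded.
Definition bop_one : bop H := Bop bop_one_bounded.
Definition bop_add S T : bop H := Bop (bop_add_bounded S T).
Definition bop_opp T : bop H := Bop (bop_opp_bounded T).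
Definition bop_mul S T : bop H := Bop (bop_mul_bounded S T).
Definition bop_scale a T : bop H := Bop (bop_scale_bounded a T).

Fact bop_addA : associative bop_add.
Proof. by move=> S T U; apply: bop_ext => x /=; rewrite addrA. Qed.
Fact bop_addC : commutative bop_add.
Proof. by move=> S T; apply: bop_ext => x /=; rewrite addrC. Qed.
Fact bop_add0 : left_id bop_zero bop_add.
Proof. by move=> S; apply: bop_ext => x /=; rewrite add0r. Qed.
Fact bop_addN : left_inverse bop_zero bop_opp bop_add.
Proof. by move=> S; apply: bop_ext => x /=; rewrite addNr. Qed.

HB.instance Definition _ :=
  GRing.isZmodule.Build (bop H) bop_addA bop_addC bop_add0 bop_addN.

Fact bop_mulA : associative bop_mul.
Proof. by move=> S T U; apply: bop_ext. Qed.
Fact bop_1mul : left_id bop_one bop_mul.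
Proof. by move=> S; apply: bop_ext. Qed.
Fact bop_mul1 : right_id bop_one bop_mul.
Proof. by move=> S; apply: bop_ext. Qed.
Fact bop_mulDl : left_distributive bop_mul bop_add.
Proof. by move=> S T U; apply: bop_ext. Qed.
Fact bop_mulDr : right_distributive bop_mul bop_add.
Proof. by move=> S T U; apply: bop_ext => x /=; rewrite bopD. Qed.

HB.instance Definition _ := GRing.Zmodule_isPzRing.Build (bop H)
  bop_mulA bop_1mul bop_mul1 bop_mulDl bop_mulDr.

Lemma real_quatM a c : real_quat a * real_quat c = real_quat (a * c).
Proof.
by congr Quat; rewrite /= ?(mulr0, mul0r, subr0, addr0).
Qed.

Lemma real_quatD a c : real_quat a + real_quat c = real_quat (a + c).
Proof. by congr Quat; rewrite /= addr0. Qed.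

Fact bop_scaleA a c T : bop_scale a (bop_scale c T) = bop_scale (a * c) T.
Proof.
by apply: bop_ext => x; rewrite /= /op_scale rscaleA real_quatM mulrC.
Qed.
Fact bop_scale1 : left_id 1 bop_scale.
Proof. by move=> T; apply: bop_ext => x; exact: rscale1. Qed.
Fact bop_scaleDr : right_distributive bop_scale +%R.
Proof. by move=> a S T; apply: bop_ext => x; exact: rscaleDr. Qed.
Fact bop_scaleDl T : {morph bop_scale^~ T : a c / a + c}.
Proof.
by move=> a c; apply: bop_ext => x; rewrite /= /op_scale -real_quatD rscaleDl.
Qed.

HB.instance Definition _ := GRing.Zmodule_isLmodule.Build R (bop H)
  bop_scaleA bop_scale1 bop_scaleDr bop_scaleDl.

Lemma bopDE S T x : (S + T) x = S x + T x. Proof. by []. Qed.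
Lemma bopNE T x : (- T) x = - T x. Proof. by []. Qed.
Lemma bopME S T x : (S * T) x = S (T x). Proof. by []. Qed.
Lemma bopZE a T x : (a *: T) x = T x *> real_quat a. Proof. by []. Qed.
Lemma bop1E x : (1 : bop H) x = x. Proof. by []. Qed.
Lemma bop0E x : (0 : bop H) x = 0. Proof. by []. Qed.

Definition bopE := (bopDE, bopNE, bopME, bopZE, bop1E, bop0E).

Local Notation "c %:O" := (c *: (1 : bop H)) (format "c %:O").

Lemma bop_scalerAl a S T : a *: (S * T) = (a *: S) * T.
Proof. exact: bop_ext. Qed.

Lemma bop_scalerAr a S T : a *: (S * T) = S * (a *: T).
Proof. by apply: bop_ext => x; rewrite !bopE bopZ. Qed.

Lemma bop_mulA4 S T S' T' : (S * T) * (S' * T') = S * (T * S') * T'.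
Proof. by rewrite !mulrA. Qed.

Lemma bop_mulA5 S T U S' T' : (S * T) * U * (S' * T') = S * (T * U * S') * T'.
Proof. by rewrite !mulrA. Qed.

Lemma bop_conjK S S' T : S * S' = 1 -> S' * S = 1 -> S * (S' * T * S') * S = T.
Proof. by move=> h h'; rewrite !mulrA h mul1r -mulrA h' mulr1. Qed.

Lemma bop_conj_scalar S c : S * (c *: (1 : bop H)) * S = c *: (S * S).
Proof. by rewrite -bop_scalerAr mulr1 -bop_scalerAl. Qed.

Lemma bop_similarX S S' T n : S * S' = 1 -> S' * S = 1 ->
  (S * T * S') ^+ n = S * T ^+ n * S'.
Proof.
move=> h h'; elim: n => [|n IH]; first by rewrite !expr0 mulr1 h.
by rewrite exprS IH exprS bop_mulA4 !mulrA -[S * T * S' * S]mulrA h' mulr1.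
Qed.

Lemma bop_conj_shift S T c : S * (T - c *: (1 : bop H)) * S = S * T * S - c *: (S * S).
Proof.
by rewrite mulrBr mulrBl -bop_scalerAr mulr1 -bop_scalerAl.
Qed.

(** * Adjoints, the operator order and norm bounds *)

Definition rdotE := (@rdotDl R H, @rdotDr R H, @rdotNl R H, @rdotNr R H,
  @rdotZl R H, @rdotZr R H, @rdot0l R H, @rdot0r R H).

(** For right linear maps, adjointness for the real form is quaternionic adjointness, since the
    values Re <u, v p> for all p determine <u, v>. *)
Definition adj S T := forall x y, rdot (S x) y = rdot x (T y).

Lemma adjC S T : adj S T -> adj T S.
Proof. by move=> h x y; rewrite rdotC -h rdotC. Qed.

Lemma adjD S S' T T' : adj S S' -> adj T T' -> adj (S + T) (S' + T').
Proof. by move=> h k x y; rewrite !bopE !rdotE h k. Qed.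

Lemma adjN S S' : adj S S' -> adj (- S) (- S').
Proof. by move=> h x y; rewrite !bopE !rdotE h. Qed.

Lemma adjB S S' T T' : adj S S' -> adj T T' -> adj (S - T) (S' - T').
Proof. by move=> h k; apply: adjD => //; apply: adjN. Qed.

Lemma adjZ a S S' : adj S S' -> adj (a *: S) (a *: S').
Proof. by move=> h x y; rewrite !bopE !rdotE h. Qed.

Lemma adjM S S' T T' : adj S S' -> adj T T' -> adj (S * T) (T' * S').
Proof. by move=> h k x y; rewrite !bopE h k. Qed.

Lemma adj1 : adj 1 1. Proof. by []. Qed.
Lemma adj0 : adj 0 0. Proof. by move=> x y; rewrite !bopE !rdotE. Qed.

Lemma adjX T n : adj T T -> adj (T ^+ n) (T ^+ n).
Proof.
move=> h; elim: n => [|n IH]; first exact: adj1.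
by rewrite {1}exprS exprSr; apply: adjM.
Qed.

(** Symmetry is demanded because nonnegativity of the real form does not imply it, whereas reality
    of all <T x, x> does. *)
Definition pos T := adj T T /\ forall x, 0 <= rdot (T x) x.
Definition ople S T := pos (T - S).
Local Notation "S <=o T" := (ople S T) (at level 70).

Lemma ople_refl T : T <=o T.
Proof.
by rewrite /ople subrr; split=> [|x]; [exact: adj0 | rewrite !bopE !rdotE].
Qed.

Lemma pos_add S T : pos S -> pos T -> pos (S + T).
Proof.
move=> [aS pS] [aT pT]; split=> [|x]; first exact: adjD.
by rewrite !bopE !rdotE addr_ge0.
Qed.

Lemma pos_scale a T : 0 <= a -> pos T -> pos (a *: T).
Proof.
move=> a0 [aT pT]; split=> [|x]; first exact: adjZ.
by rewrite !bopE !rdotE mulr_ge0.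
Qed.

Lemma pos1 : pos 1.
Proof. by split=> [|x]; [exact: adj1 | exact: rdot_ge0]. Qed.

Lemma ople_trans T S U : S <=o T -> T <=o U -> S <=o U.
Proof.
move=> h k; have := pos_add k h.
by rewrite addrA subrK.
Qed.

Lemma opleE S T x : S <=o T -> rdot (S x) x <= rdot (T x) x.
Proof. by case=> _ /(_ x); rewrite !bopE !rdotE subr_ge0. Qed.

Lemma ople_adj S T : adj S S -> adj T T ->
  (forall x, rdot (S x) x <= rdot (T x) x) -> S <=o T.
Proof.
move=> aS aT h; split=> [|x]; first exact: adjB.
by rewrite !bopE !rdotE subr_ge0.
Qed.

Lemma ople0 T : (0 <=o T) = pos T.
Proof. by rewrite /ople subr0. Qed.

Lemma opleD S S' T T' : S <=o S' -> T <=o T' -> S + T <=o S' + T'.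
Proof.
move=> h k; have := pos_add h k.
by rewrite addrACA -opprD.
Qed.

Lemma opleZ a S T : 0 <= a -> S <=o T -> a *: S <=o a *: T.
Proof. by move=> a0 h; rewrite /ople -scalerBr; apply: pos_scale. Qed.

Lemma opleZl a c T : a <= c -> pos T -> a *: T <=o c *: T.
Proof. by move=> ac h; rewrite /ople -scalerBl; apply: pos_scale; rewrite ?subr_ge0. Qed.

Lemma pos_conj C D T : adj C D -> pos T -> pos (D * T * C).
Proof.
move=> h [aT pT]; split=> [|x].
  by rewrite -{2}mulrA; apply: adjM => //; apply: adjM => //; apply: adjC.
by rewrite !bopE (adjC h).
Qed.

Lemma ople_conj C D S T : adj C D -> S <=o T -> D * S * C <=o D * T * C.
Proof.
move=> h k; have := pos_conj h k.
by rewrite /ople mulrBr mulrBl.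
Qed.

Lemma pos_adjM C D : adj C D -> pos (D * C).
Proof. by move=> h; rewrite -[D]mulr1; apply: pos_conj pos1. Qed.

(** The error may be a small multiple of any fixed operator: it disappears in each quadratic form as
    e tends to 0. *)
Lemma ople_lim S T U :
  (forall e, 0 < e -> S <=o T + e *: U) -> adj S S -> adj T T -> S <=o T.
Proof.
move=> h aS aT; apply: ople_adj => // x; apply/ler_addgt0Pr => e e0.
pose d := e / (`|rdot (U x) x| + 1).
have n0 : 0 < `|rdot (U x) x| + 1 by rewrite ltr_wpDl.
have d0 : 0 < d by rewrite divr_gt0.
apply: le_trans (opleE x (h d d0)) _; rewrite !bopE !rdotE lerD2l.
rewrite /d mulrAC ler_pdivrMr // ler_pM2l //.
by rewrite (le_trans (ler_norm _)) // lerDl.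
Qed.

(** The discriminant of t -> <T (x + t y), x + t y>. *)
Lemma pos_CauchySchwarz T x y : pos T ->
  rdot (T x) y ^+ 2 <= rdot (T x) x * rdot (T y) y.
Proof.
move=> [aT pT]; apply: discr_le => [//|t].
have := pT (x + y *> real_quat t); rewrite bopD bopZ !rdotE.
by rewrite (aT y x) (rdotC y); congr (_ <= _); ring.
Qed.

(** Cauchy-Schwarz for the form of T at x and T x gives |T x|^4 <= <T x, x> <T T x, T x> <= c |x|^2
    c |T x|^2. *)
Lemma pos_norm T c x : 0 <= c -> pos T -> T <=o c%:O ->
  qnorm (T x) <= c * qnorm x.
Proof.
move=> c0 pT hT; apply: qnorm_le; first by rewrite mulr_ge0 ?qnorm_ge0.
have b z : rdot (T z) z <= c * rdot z z.
  by have := opleE z hT; rewrite !bopE !rdotE.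
have := pos_CauchySchwarz x (T x) pT.
set n := rdot (T x) (T x) => h.
have n0 : 0 <= n := rdot_ge0 _.
rewrite exprMn sqr_qnorm.
have [->|n_neq0] := eqVneq n 0; first by rewrite mulr_ge0 ?sqr_ge0 ?rdot_ge0.
have n_gt0 : 0 < n by rewrite lt_def n_neq0.
rewrite -(ler_pM2r n_gt0) -expr2; apply: le_trans h _.
have -> : c ^+ 2 * rdot x x * n = (c * rdot x x) * (c * n) by ring.
by apply: ler_pM; [exact: pT.2 | exact: pT.2 | exact: b | exact: b].
Qed.

Definition opnorm_le T c := forall x, qnorm (T x) <= c * qnorm x.

(* For commuting S, S' one has
   (S + S') S S' = S S' S + S' S S', a sum of conjugates. *)
Lemma sym_norm T c : 0 < c -> adj T T ->
  (- c)%:O <=o T -> T <=o c%:O -> opnorm_le T c.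
Proof.
move=> c0 aT h1 h2 x.
have p1 : pos (c%:O + T).
  by have := h1; rewrite /ople scaleNr opprK addrC.
have p2 : pos (c%:O - T) by [].
have q1 := pos_conj p1.1 p2; have q2 := pos_conj p2.1 p1.
apply: qnorm_le; first by rewrite mulr_ge0 ?qnorm_ge0 // ltW.
have := (pos_add q1 q2).2 x.
(* The sum of the two conjugates collapses to 2 c (c^2 - T^2), whose positivity is |T x|^2 <= c^2
   |x|^2. *)
have -> : (c%:O + T) * (c%:O - T) * (c%:O + T) +
   (c%:O - T) * (c%:O + T) * (c%:O - T) = (2 * c) *: ((c ^+ 2)%:O - T * T).
  have e : (c%:O + T) * (c%:O - T) = (c ^+ 2)%:O - T * T.
    rewrite mulrDl !mulrBr -!bop_scalerAl -!bop_scalerAr !mul1r !mulr1.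
    by rewrite scalerA -expr2 addrA subrK.
  have e' : (c%:O - T) * (c%:O + T) = (c ^+ 2)%:O - T * T.
    rewrite mulrBl !mulrDr -!bop_scalerAl -!bop_scalerAr !mul1r !mulr1.
    by rewrite scalerA -expr2 opprD addrA addrK.
  rewrite e e' -mulrDr addrACA subrr addr0 -scalerDl -bop_scalerAr mulr1.
  by congr (_ *: _); ring.
rewrite !bopE !rdotE pmulr_rge0 ?mulr_gt0 // subr_ge0 (aT (T x)).
by rewrite exprMn sqr_qnorm.
Qed.

Lemma opnorm_ople T c : adj T T -> opnorm_le T c -> T <=o c%:O.
Proof.
move=> aT h; apply: ople_adj => [//||x]; first exact: adjZ adj1.
rewrite !bopE !rdotE -sqr_qnorm expr2 mulrA.
rewrite (le_trans (rdot_le (T x) x)) // ler_wpM2r ?qnorm_ge0 //; exact: h.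
Qed.

Lemma opnormD S T c d : opnorm_le S c -> opnorm_le T d ->
  opnorm_le (S + T) (c + d).
Proof.
move=> h k x; rewrite mulrDl; apply: le_trans (qnormD _ _) _.
exact: lerD (h x) (k x).
Qed.

Lemma opnormN T c : opnorm_le T c -> opnorm_le (- T) c.
Proof. by move=> h x; rewrite !bopE qnormN. Qed.

Lemma opnormM S T c d : 0 <= c -> opnorm_le S c -> opnorm_le T d ->
  opnorm_le (S * T) (c * d).
Proof.
move=> c0 h k x; rewrite bopME; apply: le_trans (h _) _.
by rewrite -mulrA ler_wpM2l.
Qed.

Lemma opnormZ a T c : opnorm_le T c -> opnorm_le (a *: T) (`|a| * c).
Proof. by move=> h x; rewrite bopZE qnormZr -mulrA ler_wpM2l. Qed.

Lemma opnorm_le_trans T c d : c <= d -> opnorm_le T c -> opnorm_le T d.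
Proof.
by move=> cd h x; apply: le_trans (h x) _; rewrite ler_wpM2r ?qnorm_ge0.
Qed.

Lemma opnorm_eq S T c : (forall e, 0 < e -> opnorm_le (S - T) (e * c)) -> S = T.
Proof.
move=> h; apply: bop_ext => x; apply/eqP; rewrite -subr_eq0; apply/eqP.
apply: (@qnorm_small _ _ _ (c * qnorm x)) => e e0.
by rewrite mulrA; apply: h.
Qed.

(** The defect of symmetry of S equals that of S - T for symmetric T, and S - T is small. *)
Lemma adj_lim S c :
  (forall e, 0 < e -> exists2 T, adj T T & opnorm_le (S - T) (e * c)) -> adj S S.
Proof.
move=> h x y; apply/eqP; rewrite -subr_eq0 -normr_eq0; apply/eqP.
apply: le_anti; rewrite normr_ge0 andbT; apply/ler_addgt0Pr => e e0.
pose k := qnorm x * qnorm y * `|c| * 2 + 1.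
have k0 : 0 < k by rewrite ltr_wpDl // !mulr_ge0 ?qnorm_ge0.
have [T aT hT] := h (e / k) (divr_gt0 e0 k0).
have -> : rdot (S x) y - rdot x (S y) = rdot ((S - T) x) y - rdot x ((S - T) y).
  by rewrite !bopE !rdotE aT; ring.
have cs u v : `|rdot u v| <= qnorm u * qnorm v.
  rewrite ler_norml rdot_le andbT lerNl -rdotNl.
  by rewrite (le_trans (rdot_le _ _)) // qnormN.
have b1 : `|rdot ((S - T) x) y| <= e / k * c * (qnorm x * qnorm y).
  by rewrite (le_trans (cs _ _)) // mulrA ler_wpM2r ?qnorm_ge0.
have b2 : `|rdot x ((S - T) y)| <= e / k * c * (qnorm x * qnorm y).
  rewrite (le_trans (cs _ _)) // [_ * (_ * _)]mulrCA ler_wpM2l ?qnorm_ge0 //.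
apply: le_trans (ler_normB _ _) _; apply: le_trans (lerD b1 b2) _.
have -> : 0 + e = e / k * k by rewrite add0r divfK // gt_eqF.
have d0 : 0 < e / k by rewrite divr_gt0.
rewrite -![e / k * c * _]mulrA -mulrDr ler_pM2l // /k.
have N0 : 0 <= qnorm x * qnorm y by rewrite mulr_ge0 ?qnorm_ge0.
have := ler_norm c; nra.
Qed.

End BoundedOperators.

Notation "S <=o T" := (ople S T) (at level 70).

(** * Completeness of the algebra and inverses of strictly positive operators *)

Section Inverses.
Variables (R : realType) (H : qhilbertType R).
Implicit Types (S T : bop H) (u v x y : H) (a c s : R).
Local Notation "c %:O" := (c *: (1 : bop H)) (format "c %:O").

(** Pointwise limits exist by completeness of H; the Cauchy bound passes to the limit, which makes
    the convergence uniform and the limit linear and bounded. *)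
Lemma bop_complete (F : nat -> bop H) :
  (forall e, 0 < e -> exists N, forall m n, (N <= m)%N -> (N <= n)%N ->
     opnorm_le (F m - F n) e) ->
  exists T, forall e, 0 < e -> exists N, forall n, (N <= n)%N ->
     opnorm_le (F n - T) e.
Proof.
move=> cF.
have lim x : exists l, forall e, 0 < e -> exists N, forall n, (N <= n)%N ->
    qnorm (F n x - l) < e.
  apply: qhilbert_complete => e e0.
  have x1 : 0 < qnorm x + 1 by rewrite ltr_wpDl ?qnorm_ge0.
  have [N hN] := cF (e / (qnorm x + 1)) (divr_gt0 e0 x1).
  exists N => m n Nm Nn; have := hN m n Nm Nn x; rewrite !bopE => h.
  apply: le_lt_trans h _; rewrite mulrAC ltr_pdivrMr // ltr_pM2l //.
  by rewrite ltrDl.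
have [L hL] := choice lim.
have unif e : 0 < e -> exists N, forall n x, (N <= n)%N ->
    qnorm (F n x - L x) <= e * qnorm x.
  move=> e0; have [N hN] := cF e e0; exists N => n x Nn.
  (* The intermediate index depends on x through M, but N and the resulting bound do not. *)
  apply/ler_addgt0Pr => d d0; have [M hM] := hL x d d0.
  have -> : F n x - L x = (F n - F (maxn N M)) x + (F (maxn N M) x - L x).
    by rewrite !bopE addrA subrK.
  apply: le_trans (qnormD _ _) _; apply: lerD.
    by apply: hN => //; rewrite leq_maxl.
  by apply/ltW/hM; rewrite leq_maxr.
have bL : bounded_op L.
  split=> [u v p|]; last first.
    have [N hN] := unif 1 ltr01; have [c c0 hc] := bop_bound (F N).
    exists (1 + c) => x; rewrite mulrDl.
    have -> : L x = - (F N x - L x) + F N x by rewrite opprB subrK.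
    apply: le_trans (qnormD _ _) _; rewrite qnormN.
    by apply: lerD => //; apply: hN.
  (* The defect of linearity of L is minus that of L - F n, which is arbitrarily small. *)
  apply/eqP; rewrite -subr_eq0; apply/eqP.
  pose w := u *> p + v.
  apply: (@qnorm_small _ _ _
    (qnorm w + Num.sqrt (normq2 p) * qnorm u + qnorm v)) => e e0.
  have [N hN] := unif e e0.
  have -> : L w - (L u *> p + L v) =
      - (F N w - L w) + (F N u - L u) *> p + (F N v - L v).
    have -> : (F N u - L u) *> p = F N u *> p - L u *> p.
      by rewrite /rscale scalerBr.
    rewrite /w bopD bopZ; set a := F N u *> p; set b := F N v.
    rewrite opprB -[RHS]addrA [a - _ + _]addrACA -opprD [_ - _ + _]addrA.
    by rewrite subrK.
  apply: le_trans (qnormD _ _) _; rewrite !mulrDr; apply: lerD; last exact: hN.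
  apply: le_trans (qnormD _ _) _; apply: lerD; first by rewrite qnormN; exact: hN.
  by rewrite qnormZ mulrCA ler_wpM2l ?sqrtr_ge0 //; exact: hN.
exists (Bop bL) => e e0; have [N hN] := unif e e0.
by exists N => n Nn x; rewrite !bopE; exact: hN.
Qed.

Definition bdd_below T c := forall x, c * qnorm x <= qnorm (T x).

Lemma bdd_below_inj T c x y : 0 < c -> bdd_below T c -> T x = T y -> x = y.
Proof.
move=> c0 h E; apply/eqP; rewrite -subr_eq0; apply/eqP; apply: qnorm_eq0.
have := h (x - y); rewrite bopB E subrr qnorm0 pmulr_rle0 // => le0.
by apply: le_anti; rewrite le0 qnorm_ge0.
Qed.

Lemma bdd_belowM S T c d : 0 <= c -> bdd_below S c -> bdd_below T d ->
  bdd_below (S * T) (c * d).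
Proof.
move=> c0 h k x; apply: le_trans (h _).
by rewrite -mulrA ler_wpM2l.
Qed.

Lemma bdd_belowN T c : bdd_below (- T) c -> bdd_below T c.
Proof. by move=> h x; have := h x; rewrite !bopE qnormN. Qed.

(** Cauchy-Schwarz: c |x|^2 <= <T x, x> <= |T x| |x|. *)
Lemma ople_bdd_below T c : c%:O <=o T -> bdd_below T c.
Proof.
move=> h x; have [x0|x0] := eqVneq (qnorm x) 0.
  by rewrite x0 mulr0 qnorm_ge0.
have x_gt0 : 0 < qnorm x by rewrite lt_def x0 qnorm_ge0.
rewrite -(ler_pM2r x_gt0) -mulrA -expr2 sqr_qnorm.
apply: le_trans (rdot_le _ _).
by have := opleE x h; rewrite !bopE rdotZl.
Qed.

Lemma expr_small (t e : R) : 0 <= t < 1 -> 0 < e ->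
  exists N, forall n, (N <= n)%N -> t ^+ n <= e.
Proof.
move=> /andP[t0 t1] e0; have : `|t| < 1 by rewrite ger0_norm.
move=> /cvg_expr /cvgrPdist_le /(_ e e0) [N _ hN].
exists N => n /hN; rewrite sub0r normrN ger0_norm //.
exact: exprn_ge0.
Qed.

Lemma opnormX T c n : 0 <= c -> opnorm_le T c -> opnorm_le (T ^+ n) (c ^+ n).
Proof.
move=> c0 h; elim: n => [|n IH]; first by move=> x; rewrite expr0 mul1r.
by rewrite !exprS; apply: opnormM.
Qed.

(* Neumann series of [P / M = 1 - N], where [N] is a contraction. *)
Lemma pos_invertible P c M : 0 < c -> adj P P -> c%:O <=o P -> P <=o M%:O ->
  exists Q, P * Q = 1 /\ Q * P = 1.
Proof.
move=> c0 aP cP PM0.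
(* On the zero space M may be any real, so it is first replaced by a positive bound that is at least
   c. *)
have [M' [M0 cM PM]] : exists M', [/\ 0 < M', c <= M' & P <=o M'%:O].
  exists (`|M| + c); split; first by rewrite ltr_wpDl.
    by rewrite lerDr.
  apply: ople_trans PM0 _; apply: opleZl; last exact: pos1.
  by rewrite (le_trans (ler_norm _)) // lerDl ltW.
pose A := M'^-1 *: P; pose N := 1 - A; pose t := 1 - c / M'.
have t01 : 0 <= t < 1.
  rewrite /t subr_ge0 ler_pdivrMr // mul1r cM /=.
  by rewrite ltrBlDr ltrDl divr_gt0.
have cA : (c / M')%:O <=o A.
  by rewrite mulrC -scalerA; apply: opleZ cP; rewrite invr_ge0 ltW.
have pN : pos N.
  rewrite -[N]/(1 - A) -/(ople A 1) /A.
  have -> : (1 : bop H) = M'^-1 *: M'%:O.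
    by rewrite scalerA mulVf ?scale1r // gt_eqF.
  by apply: opleZ => //; rewrite invr_ge0 ltW.
have Nt : N <=o t%:O.
  by move: cA; rewrite /ople /N /t scalerBl scale1r opprB [1 - _ + _]addrC addrA subrK.
have nN : opnorm_le N t by move=> x; apply: pos_norm => //; case/andP: t01.
have bA := ople_bdd_below cA; have cM0 : 0 < c / M' by rewrite divr_gt0.
have t0 : 0 <= t by case/andP: t01.
pose G n := \sum_(i < n) N ^+ i.
have AG n : A * G n = 1 - N ^+ n.
  by rewrite -[RHS]opprB subrX1 /N -mulNr opprB opprB addrCA subrr addr0.
have [Q hQ] : exists T, forall e, 0 < e -> exists N, forall n, (N <= n)%N ->
     opnorm_le (G n - T) e.
  apply: bop_complete => e e0.
  have e1 : 0 < e * (c / M') / 2 by rewrite divr_gt0 // mulr_gt0.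
  have [K hK] := expr_small t01 e1; exists K => m n Km Kn x.
  (* The partial sums are compared after applying A, which is bounded below and turns their
     difference into N^n - N^m. *)
  rewrite -(ler_pM2l cM0); apply: le_trans (bA _) _.
  have -> : A ((G m - G n) x) = (N ^+ n - N ^+ m) x.
    by rewrite -bopME mulrBr !AG opprB addrC addrA subrK.
  have h := opnormD (opnormX n t0 nN) (opnormN (opnormX m t0 nN)).
  apply: le_trans (h x) _; rewrite mulrA ler_wpM2r ?qnorm_ge0 //.
  have := lerD (hK n Kn) (hK m Km); rewrite -splitr.
  by rewrite [e * _]mulrC.
have [C C0 hC] := bop_bound A.
have AQ : A * Q = 1.
  apply: (@opnorm_eq _ _ _ _ (C + 1)) => e e0.
  have [K1 hK1] := hQ e e0; have [K2 hK2] := expr_small t01 e0.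
  pose n := maxn K1 K2.
  have -> : A * Q - 1 = A * - (G n - Q) + - N ^+ n.
    by rewrite mulrN mulrBr AG !opprB [_ ^+ n - 1]addrC addrA addrK.
  rewrite mulrDr mulr1 [e * C]mulrC; apply: opnormD.
    apply: opnormM; [exact: ltW|exact: hC|apply: opnormN].
    by apply: hK1; rewrite leq_maxl.
  apply: opnormN; apply: opnorm_le_trans (opnormX n t0 nN).
  by apply: hK2; rewrite leq_maxr.
(* A is injective and A Q A = A. *)
have QA : Q * A = 1.
  apply: bop_ext => x; apply: (bdd_below_inj cM0 bA).
  by rewrite -!bopME mulrA AQ mul1r mulr1.
exists (M'^-1 *: Q); split.
  by rewrite -bop_scalerAr bop_scalerAl.
by rewrite -bop_scalerAl bop_scalerAr.
Qed.

End Inverses.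

(** * Polynomials of an operator and its spectrum *)

Section PolynomialCalculus.
Variables (R : realType) (H : qhilbertType R).
Implicit Types (S T : bop H) (x y : H) (a c s : R) (p q : {poly R}).
Local Notation "c %:O" := (c *: (1 : bop H)) (format "c %:O").

(** For q = s real, q + conj q = 2 s and |q|^2 = s^2, so s lies in the spectrum exactly when (T -
    s)^2 is not invertible. *)
Lemma Delta_real T s :
  Delta T (real_quat s) = ((T - s%:O) * (T - s%:O) : bop H).
Proof.
apply/funext => x; rewrite !bopE bopB bopZ.
rewrite /Delta /= /op_scale /normq2 /= !expr0n /= !addr0.
have -> : real_quat s + conjq (real_quat s) = real_quat s + real_quat s.
  by congr (_ + _); congr Quat; rewrite oppr0.
rewrite rscaleDl.
have -> : s ^+ 2 = s * s by [].
rewrite -real_quatM -rscaleA.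
have -> : (T x - x *> real_quat s) *> real_quat s =
          T x *> real_quat s - x *> real_quat s *> real_quat s.
  exact: scalerBr.
by rewrite opprB opprD addrA -!addrA; congr (_ + (_ + _)); rewrite addrC.
Qed.

(** If S inverts (T - s)^2, then S (T - s) is a bounded left inverse of T - s; c is the inverse of
    its bound. *)
Lemma not_rspectrum_bdd_below T s : ~ rspectrum T s ->
  exists2 c, 0 < c & bdd_below (T - s%:O) c.
Proof.
move=> /contrapT [S bS []]; rewrite Delta_real => SK _.
have [c c0 hc] := bop_bound (Bop bS * (T - s%:O)).
exists c^-1; first by rewrite invr_gt0.
move=> x; rewrite ler_pdivrMl //; apply: le_trans (hc _).
by have -> : (Bop bS * (T - s%:O)) ((T - s%:O) x) = x by exact: SK.
Qed.

(** For symmetric T the square satisfies c^2 <= (T - s)^2 <= C^2, so the Neumann series inverts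
    it. *)
Lemma bdd_below_not_rspectrum T s c : adj T T -> 0 < c ->
  bdd_below (T - s%:O) c -> ~ rspectrum T s.
Proof.
move=> aT c0 h; rewrite /rspectrum /sspectrum /=; apply.
set S := T - s%:O; have aS : adj S S.
  by apply: adjB => //; apply: adjZ; exact: adj1.
have [C C0 hC] := bop_bound S.
have aSS : adj (S * S) (S * S) by apply: adjM.
have [Q [SQ QS]] : exists Q, S * S * Q = 1 /\ Q * (S * S) = 1.
  apply: (@pos_invertible _ _ _ (c ^+ 2) (C ^+ 2)) => //.
  - by rewrite exprn_gt0.
  - apply: ople_adj => [|//|x]; first by apply: adjZ; exact: adj1.
    rewrite bopZE bop1E bopME rdotZl aS -!sqr_qnorm -exprMn.
    rewrite ler_sqr ?nnegrE ?qnorm_ge0 ?mulr_ge0 ?qnorm_ge0 ?(ltW c0) ?(ltW C0) //.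
  - apply: ople_adj => [//||x]; first by apply: adjZ; exact: adj1.
    rewrite bopZE bop1E bopME rdotZl aS -!sqr_qnorm -exprMn.
    rewrite ler_sqr ?nnegrE ?qnorm_ge0 ?mulr_ge0 ?qnorm_ge0 ?(ltW c0) ?(ltW C0) //.
exists (Q : H -> H); first exact: bop_fun_bounded.
by rewrite Delta_real; split=> x; rewrite -bopME ?SQ ?QS.
Qed.

(** For s < m, T - s >= m - s > 0 is bounded below. *)
Lemma rspectrum_ge T m s : adj T T -> m%:O <=o T -> rspectrum T s -> m <= s.
Proof.
move=> aT hm sT; rewrite leNgt; apply/negP => ms.
apply: (@bdd_below_not_rspectrum T s (m - s)) sT; rewrite ?subr_gt0 //.
apply: ople_bdd_below; move: hm; rewrite /ople scalerBl opprB.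
by rewrite addrA subrK.
Qed.

Lemma rspectrum_le T m s : adj T T -> T <=o m%:O -> rspectrum T s -> s <= m.
Proof.
move=> aT hm sT; rewrite leNgt; apply/negP => ms.
apply: (@bdd_below_not_rspectrum T s (s - m)) sT; rewrite ?subr_gt0 //.
apply/bdd_belowN/ople_bdd_below; move: hm; rewrite /ople scalerBl !opprB.
by rewrite [s%:O - T + _]addrC addrA subrK.
Qed.

(** A lower bound c for T - s leaves the lower bound c / 2 for T - t when |t - s| < c / 2, so the
    complement is open. *)
Lemma closed_rspectrum T : adj T T -> closed (rspectrum T).
Proof.
move=> aT; rewrite -[rspectrum T]setCK closedC openE => s /= sT.
have [c c0 hc] := not_rspectrum_bdd_below sT.
apply/nbhs_ballP; exists (c / 2) => /=; first by rewrite divr_gt0.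
move=> t; rewrite /ball /= => st.
apply: (@bdd_below_not_rspectrum T t (c / 2)) => //; first by rewrite divr_gt0.
move=> x; have -> : T - t%:O = (T - s%:O) - (t - s)%:O.
  by rewrite scalerBl opprB addrA subrK.
have := qnormDN ((T - s%:O) x) (x *> real_quat (t - s)).
rewrite qnormZr; have := hc x; have := ler_wpM2r (qnorm_ge0 x) (ltW st).
rewrite bopDE bopNE bopZE bop1E distrC; lra.
Qed.

Definition peval T p : bop H := \sum_(i < size p) p`_i *: T ^+ i.

Lemma peval_wide T p n : (size p <= n)%N ->
  peval T p = \sum_(i < n) p`_i *: T ^+ i.
Proof.
move=> pn; rewrite /peval (big_ord_widen _ (fun i => p`_i *: T ^+ i) pn).
rewrite big_mkcond /=; apply: eq_bigr => i _.
by case: ltnP => // h; rewrite nth_default // scale0r.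
Qed.

Lemma pevalD T p q : peval T (p + q) = peval T p + peval T q.
Proof.
pose n := maxn (size p) (size q).
rewrite (@peval_wide T p n) ?leq_maxl // (@peval_wide T q n) ?leq_maxr //.
rewrite (@peval_wide T (p + q) n) ?size_polyD // -big_split /=.
by apply: eq_bigr => i _; rewrite coefD scalerDl.
Qed.

Lemma pevalZ T a p : peval T (a *: p) = a *: peval T p.
Proof.
rewrite (@peval_wide T (a *: p) (size p)) ?size_scale_leq // scaler_sumr.
by apply: eq_bigr => i _; rewrite coefZ scalerA.
Qed.

Lemma pevalC T a : peval T a%:P = a%:O.
Proof.
rewrite (@peval_wide T _ 1%N) ?size_polyC ?leq_b1 //.
by rewrite big_ord1 coefC.
Qed.

Lemma pevalMX T p : peval T (p * 'X) = peval T p * T.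
Proof.
rewrite (@peval_wide T (p * 'X) (size p).+1); last first.
  by rewrite (leq_trans (size_polyMleq _ _)) // size_polyX addn2.
rewrite big_ord_recl coefMX /= scale0r add0r mulr_suml.
by apply: eq_bigr => i _; rewrite coefMX /= exprSr bop_scalerAl.
Qed.

Lemma pevalX T : peval T 'X = T.
Proof. by rewrite -['X]mul1r pevalMX pevalC scale1r mul1r. Qed.

Lemma pevalM T p q : peval T (p * q) = peval T p * peval T q.
Proof.
elim/poly_ind: q => [|q c IH].
  by rewrite mulr0 -[0 in LHS]polyC0 -[0 in RHS]polyC0 pevalC scale0r mulr0.
rewrite mulrDr mulrA !pevalD !pevalMX mulrDr IH pevalC mulrC mul_polyC pevalZ.
by rewrite -bop_scalerAr mulr1 mulrA.
Qed.

Lemma pevalN T p : peval T (- p) = - peval T p.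
Proof. by rewrite -scaleN1r pevalZ scaleN1r. Qed.

Lemma pevalB T p q : peval T (p - q) = peval T p - peval T q.
Proof. by rewrite pevalD pevalN. Qed.

Lemma peval_adj T p : adj T T -> adj (peval T p) (peval T p).
Proof.
move=> aT; rewrite /peval; elim/big_ind: _ => [|S S' h h'|i _].
- exact: adj0.
- exact: adjD.
- by apply: adjZ; apply: adjX.
Qed.

(** Take a complex root a + i b. If b = 0 it gives a linear factor. Otherwise the remainder modulo
    (X - a)^2 + b^2 is real, of degree at most 1, and vanishes at a + i b, hence is zero. *)
Lemma real_poly_factor p : (1 < size p)%N ->
  exists q, (exists a, p = q * ('X - a%:P)) \/
    (exists a b, b != 0 /\ p = q * (('X - a%:P) ^+ 2 + (b ^+ 2)%:P)).
Proof.
move=> p1; pose pC := map_poly (real_complex R) p.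
have /closed_rootP[[a b] rz] : size pC != 1%N by rewrite size_map_poly gtn_eqF.
have [b0|b0] := eqVneq b 0.
  have /factor_theorem[q ->] : root p a.
    by rewrite -(fmorph_root (real_complex R)) /= -/pC; rewrite b0 in rz.
  by exists q; left; exists a.
pose d : {poly R} := ('X - a%:P) ^+ 2 + (b ^+ 2)%:P.
have sd : size d = 3%N.
  by rewrite /d size_polyDl size_exp_XsubC // size_polyC; case: (_ != 0).
have d0 : d != 0 by rewrite -size_poly_gt0 sd.
have dz : (map_poly (real_complex R) d).[Complex a b] = 0.
  rewrite /d rmorphD rmorphXn /= map_polyXsubC map_polyC /=.
  rewrite hornerD horner_exp hornerXsubC hornerC.
  by apply/eqP; rewrite eq_complex expr2 /=; apply/andP; split; apply/eqP; ring.
have : (map_poly (real_complex R) (p %% d)).[Complex a b] = 0.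
  move: rz; rewrite rootE /pC {1}(divp_eq p d) rmorphD rmorphM /= hornerD hornerM.
  by rewrite dz mulr0 add0r => /eqP.
have sr : (size (p %% d)%R <= 2)%N by rewrite -ltnS -sd ltn_modp.
have er : p %% d = (p %% d)`_1 *: 'X + ((p %% d)`_0)%:P.
  apply/polyP => i; rewrite coefD coefZ coefX coefC.
  case: i => [|[|i]] /=; rewrite ?(mulr0, mulr1, addr0, add0r) //.
  by rewrite nth_default // (leq_trans sr).
rewrite er rmorphD /= map_polyZ map_polyX map_polyC /=.
rewrite hornerD hornerZ hornerX hornerC => /eqP.
rewrite eq_complex /= => /andP[/eqP re /eqP im].
have r1 : (p %% d)`_1 = 0.
  apply/eqP; move: im; rewrite mul0r addr0 addr0 => /eqP.
  by rewrite mulf_eq0 (negPf b0) orbF.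
have r0 : (p %% d)`_0 = 0 by move: re; rewrite r1 !mul0r subr0 add0r.
exists (p %/ d); right; exists a, b; split=> //.
by rewrite -/d {1}(divp_eq p d) er r1 r0 scale0r !addr0.
Qed.

(** Induction on the degree: a linear factor has its root off the spectrum, and a quadratic factor
    satisfies (T - a)^2 + b^2 >= b^2. *)
Lemma peval_bdd_below T p : adj T T -> p != 0 ->
  (forall s, root p s -> ~ rspectrum T s) ->
  exists2 c, 0 < c & bdd_below (peval T p) c.
Proof.
move=> aT; have [n] := ubnP (size p); elim: n p => // n IH p pn p0 hp.
have [p1|p1] := leqP (size p) 1.
  have [a ep] : exists a, p = a%:P by exists p`_0; exact: size1_polyC.
  move: p0; rewrite ep polyC_eq0 => a0; exists `|a|; first by rewrite normr_gt0.
  by move=> x; rewrite pevalC !bopE qnormZr.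
have qsmall q r : p = q * r -> (1 < size r)%N -> exists2 c, 0 < c & bdd_below (peval T q) c.
  move=> ep r1; have [q0 r0] : q != 0 /\ r != 0.
    by apply/andP; rewrite -negb_or -mulf_eq0 -ep.
  apply: IH => //; last by move=> s hs; apply: hp; rewrite ep rootM hs.
  move: pn; rewrite ep size_mul // -subn1 -addnBA; last by rewrite ltnW.
  by rewrite ltnS => h; apply: leq_trans h; rewrite -addn1 leq_add2l subn_gt0.
have [q [[a ep]|[a [b [b0 ep]]]]] := real_poly_factor p1.
  have [c c0 hc] := qsmall _ _ ep ltac:(by rewrite size_XsubC).
  have [d d0 hd] : exists2 c, 0 < c & bdd_below (T - a%:O) c.
    by apply/not_rspectrum_bdd_below/hp; rewrite ep rootM root_XsubC eqxx orbT.
  exists (c * d); first by rewrite mulr_gt0.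
  by rewrite ep pevalM pevalB pevalX pevalC; apply: bdd_belowM => //; exact: ltW.
have s1 : (1 < size (('X - a%:P) ^+ 2 + (b ^+ 2)%:P)%R)%N.
  by rewrite size_polyDl size_exp_XsubC // size_polyC; case: (_ != 0).
have [c c0 hc] := qsmall _ _ ep s1.
exists (c * b ^+ 2); first by rewrite mulr_gt0 // exprn_even_gt0.
rewrite ep pevalM; apply: bdd_belowM (ltW c0) hc _; apply: ople_bdd_below.
rewrite pevalD pevalC expr2 pevalM pevalB pevalX pevalC /ople addrK.
by apply: pos_adjM; apply: adjB => //; apply: adjZ; exact: adj1.
Qed.

(** The extremal m is sup [E]. A nonzero vector is required for [E] to be bounded above. *)
Lemma rspectrum_min T p : adj T T -> (1 < size p)%N -> (exists x : H, x != 0) ->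
  exists2 s, rspectrum T s & p.[s]%:O <=o peval T p.
Proof.
move=> aT p1 [x0 x0N]; apply: contrapT => hN.
have aP := peval_adj p aT; set P := peval T p in aP.
pose E : set R := [set m | m%:O <=o P]%classic.
have [C C0 hC] := bop_bound P.
have aO c : adj c%:O c%:O by apply: adjZ; exact: adj1.
have x_gt0 : 0 < rdot x0 x0.
  by rewrite lt_def rdot_ge0 andbT; apply: contra x0N => /eqP/rdot_eq0 ->.
have supE : has_sup E.
  split.
    exists (- C); rewrite /E /= /ople scaleNr opprK addrC -[P]opprK.
    by apply: opnorm_ople; [exact: adjN | exact: opnormN].
  exists C => m hm; rewrite -(ler_pM2r x_gt0).
  have := opleE x0 (ople_trans hm (opnorm_ople aP hC)).
  by rewrite !bopE !rdotZl.
have EmP : (sup E)%:O <=o P.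
  apply: (@ople_lim _ _ _ _ 1) => // e e0.
  have [m hm lm] := sup_adherent e0 supE.
  have := opleD hm (ople_refl e%:O); apply: ople_trans.
  rewrite -scalerDl; apply: opleZl; last exact: pos1.
  by rewrite -lerBlDr ltW.
pose q := p - (sup E)%:P.
(* Since p is not constant, subtracting a constant keeps its degree, so q is nonzero. *)
have sq : size q = size p.
  rewrite /q size_polyDl // size_polyN size_polyC.
  by apply: leq_ltn_trans p1; case: (_ != 0).
have q0 : q != 0 by rewrite -size_poly_gt0 sq ltnW.
have [c c0 hc] : exists2 c, 0 < c & bdd_below (peval T q) c.
  apply: peval_bdd_below => // s; rewrite rootE /q hornerD hornerN hornerC.
  rewrite subr_eq0 => /eqP es sT; apply: hN; exists s => //.
  by rewrite es.
move: hc; rewrite /q pevalB pevalC -/P => hc.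
pose K := C + `|sup E| + 1.
have K0 : 0 < K by rewrite ltr_wpDl // addr_ge0 // ltW.
have hK : P - (sup E)%:O <=o K%:O.
  have := opleD (opnorm_ople aP hC) (ople_refl (- (sup E)%:O)).
  rewrite -scalerBl => h; apply: ople_trans h _; apply: opleZl; last exact: pos1.
  by rewrite /K; have := ler_norm (- sup E); rewrite normrN; lra.
(* A positive Q <= K bounded below by c satisfies Q >= c^2 / K: Cauchy-Schwarz gives |Q x|^4 <= <Q
   x, x> K |Q x|^2, and |Q x| >= c |x|. This contradicts the maximality of sup [E]. *)
have Kb x : c ^+ 2 / K * rdot x x <= rdot ((P - (sup E)%:O) x) x.
  set Q := P - (sup E)%:O in hK hc *; have pQ : pos Q := EmP.
  rewrite mulrAC ler_pdivrMr //; have := pos_CauchySchwarz x (Q x) pQ.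
  have n0 : 0 <= rdot (Q x) (Q x) := rdot_ge0 _.
  have := opleE (Q x) hK; rewrite [(K%:O) _]bopZE bop1E rdotZl.
  have : c ^+ 2 * rdot x x <= rdot (Q x) (Q x).
    rewrite -!sqr_qnorm -exprMn ler_sqr ?nnegrE ?qnorm_ge0 //.
    by rewrite mulr_ge0 ?qnorm_ge0 // ltW.
  have q0' := pQ.2 x; move: n0 q0'.
  set n := rdot (Q x) (Q x); set q1 := rdot (Q x) x => n0 q10 h1 h2 h3.
  apply: le_trans h1 _; have [->|n_neq0] := eqVneq n 0.
    by rewrite mulr_ge0 // ltW.
  have n_gt0 : 0 < n by rewrite lt_def n_neq0.
  rewrite -(ler_pM2r n_gt0) -expr2 -mulrA; apply: le_trans h3 _.
  by rewrite ler_wpM2l.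
have : E (sup E + c ^+ 2 / K).
  apply: ople_adj => // x; have := Kb x.
  by rewrite !bopE !rdotE mulrDl; lra.
move=> /(sup_upper_bound supE); by rewrite gerDl leNgt divr_gt0 // exprn_gt0.
Qed.

Lemma peval_pos T p : adj T T -> (forall s, rspectrum T s -> 0 <= p.[s]) ->
  pos (peval T p).
Proof.
move=> aT hp; split=> [|x]; first exact: peval_adj.
have [->|x0] := eqVneq x 0; first by rewrite bop0 rdot0l.
have ex : exists x : H, x != 0 by exists x.
have scal s : rspectrum T s -> 0 <= rdot (p.[s]%:O x) x.
  by move=> sT; rewrite !bopE rdotZl mulr_ge0 ?rdot_ge0 ?hp.
have [p1|p1] := leqP (size p) 1; last first.
  have [s sT h] := rspectrum_min aT p1 ex.
  exact: le_trans (scal s sT) (opleE x h).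
(* For constant p, the polynomial X supplies a point of the spectrum, at which p is nonnegative. *)
have [s sT _] := @rspectrum_min T 'X aT ltac:(by rewrite size_polyX) ex.
by have := scal s sT; rewrite (size1_polyC p1) hornerC pevalC.
Qed.

(** Both c + p and c - p are nonnegative on the spectrum. *)
Lemma peval_opnorm T p c : adj T T -> 0 < c ->
  (forall s, rspectrum T s -> `|p.[s]| <= c) -> opnorm_le (peval T p) c.
Proof.
move=> aT c0 hp; have aP := peval_adj p aT; apply: sym_norm => //.
  rewrite /ople scaleNr opprK -(pevalC T) -pevalD; apply: peval_pos => // s /hp.
  by rewrite ler_norml hornerD hornerC => /andP[h _]; rewrite -lerBlDr sub0r.
rewrite /ople -(pevalC T) -pevalB; apply: peval_pos => // s /hp.
by rewrite ler_norml hornerD hornerN hornerC subr_ge0 => /andP[].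
Qed.

End PolynomialCalculus.

(** * Weierstrass approximation *)

Section Weierstrass.
Variable R : realType.
Implicit Types (f g h : R -> R) (u v : nat -> R) (x a b c e : R).

(* [(bernstein u n).[x]] is the expectation of [u k] when k is binomial with
   parameters n and x. *)
Fixpoint bernstein u n : {poly R} :=
  if n is n'.+1 then 'X * bernstein (u \o succn) n' + (1 - 'X) * bernstein u n'
  else (u 0%N)%:P.

Lemma bernsteinS u n x : (bernstein u n.+1).[x] =
  x * (bernstein (u \o succn) n).[x] + (1 - x) * (bernstein u n).[x].
Proof. by rewrite /= !hornerE. Qed.

Lemma bernstein_le u v n x : 0 <= x <= 1 ->
  (forall k, (k <= n)%N -> u k <= v k) ->
  (bernstein u n).[x] <= (bernstein v n).[x].
Proof.
move=> /andP[x0 x1]; elim: n u v => [|n IH] u v h.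
  by rewrite /= !hornerC h.
rewrite !bernsteinS; apply: lerD; apply: ler_wpM2l; rewrite ?subr_ge0 //.
  by apply: IH => k kn; apply: h.
by apply: IH => k kn; apply: h; apply: leqW.
Qed.

Lemma bernstein_affine u a b n x :
  (bernstein (fun k => a + b * u k) n).[x] = a + b * (bernstein u n).[x].
Proof.
elim: n u => [|n IH] u; first by rewrite /= !hornerC.
rewrite !bernsteinS IH.
have -> : (fun k => a + b * u k) \o succn = (fun k => a + b * (u \o succn) k) by [].
by rewrite IH; ring.
Qed.

(** The binomial variance n x (1 - x) plus the squared bias; conditioning on a success in one trial
    replaces c by c - 1. *)
Lemma bernstein_variance c n x :
  (bernstein (fun k => (k%:R - c) ^+ 2) n).[x] =
  n%:R * x * (1 - x) + (n%:R * x - c) ^+ 2.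
Proof.
elim: n c => [|n IH] c; first by rewrite /= hornerC; ring.
rewrite bernsteinS IH.
have -> : (fun k : nat => (k%:R - c) ^+ 2) \o succn =
          (fun k : nat => (k%:R - (c - 1)) ^+ 2).
  by apply/funext => k /=; rewrite -natr1; ring.
by rewrite IH -natr1; ring.
Qed.

(** Compactness of [0, 1] in covering form, with half radii around each point. Only x is confined to
    [0, 1]. *)
Lemma uniform_continuity f e : continuous f -> 0 < e ->
  exists2 d : R, 0 < d & forall x y, 0 <= x <= 1 -> `|x - y| < d -> `|f x - f y| <= e.
Proof.
move=> cf e0; have /compact_near_coveringP cpt := @segment_compact R 0 1.
have : (\forall d \near 0^'+, `[0, 1] `<=`
    [set x | forall y, `|x - y| < d -> `|f x - f y| <= e])%classic.
  apply: (cpt R 0^'+ (fun d x => forall y, `|x - y| < d -> `|f x - f y| <= e)).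
  move=> x _; have /cvgrPdist_le /(_ (e / 2)) := cf x.
  rewrite divr_gt0 // => /(_ isT) /nbhs_ballP[d /= d0 hd].
  exists (ball x (d / 2), [set t | t < d / 2]%classic) => /=.
    split; first by apply: nbhsx_ballx; rewrite divr_gt0.
    by apply: nbhs_right_lt; rewrite divr_gt0.
  move=> [x' t] /= [xx' td] y x'y; rewrite /ball /= in xx'.
  have h1 : `|f x - f x'| <= e / 2.
    by apply: hd; rewrite /ball /=; apply: lt_trans xx' _; lra.
  have h2 : `|f x - f y| <= e / 2.
    apply: hd; rewrite /ball /=; have := ler_distD x' x y; lra.
  by have := ler_distD (f x) (f x') (f y); rewrite [`|f x' - f x|]distrC; lra.
move=> [d0 /= d0_gt0 hd0]; exists (d0 / 2); first by rewrite divr_gt0.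
move=> x y x01 xy; apply: (hd0 (d0 / 2)) => //=.
  by rewrite sub0r normrN ger0_norm ?divr_ge0 ?ltW //; lra.
by rewrite divr_gt0.
Qed.

Lemma continuous_bounded01 f : continuous f ->
  exists2 K : R, 0 < K & forall x, 0 <= x <= 1 -> `|f x| <= K.
Proof.
move=> cf; have /compact_bounded[N [_ hN]] : compact (f @` `[0, 1])%classic.
  by apply: continuous_compact (@segment_compact R 0 1); exact: continuous_subspaceT.
exists (`|N| + 1) => [|x x01]; first by rewrite ltr_wpDl.
apply: (hN (`|N| + 1)); first by rewrite ltr_pwDr // ler_norm.
by exists x => //=; rewrite in_itv.
Qed.

(** Bernstein's proof: |f(k/n) - f(x)| <= e/2 + b (k/n - x)^2, and the binomial expectation of the
    square is x (1 - x) / n. *)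
Lemma weierstrass01 f e : continuous f -> 0 < e ->
  exists p : {poly R}, forall x, 0 <= x <= 1 -> `|p.[x] - f x| <= e.
Proof.
move=> cf e0; have e2 : 0 < e / 2 by rewrite divr_gt0.
have [d d0 hd] := uniform_continuity cf e2.
have [K K0 hK] := continuous_bounded01 cf.
(* With this b, the term b (k/n - x)^2 is at least 2 K, hence at least |f(k/n) - f(x)|, once |k/n -
   x| >= d. *)
pose b := 2 * K / d ^+ 2.
have b0 : 0 < b by rewrite divr_gt0 ?exprn_gt0 // mulr_gt0.
pose n := (Num.truncn (b / (e / 2))).+1.
have n0 : 0 < n%:R :> R by rewrite ltr0n.
have nb : b / n%:R <= e / 2.
  rewrite ler_pdivrMr // mulrC -ler_pdivrMr // ltW //.
  by rewrite /n truncnS_gt.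
exists (bernstein (fun k => f (k%:R / n%:R)) n) => x x01.
have hk k : (k <= n)%N ->
    `|f (k%:R / n%:R) - f x| <= e / 2 + b / n%:R ^+ 2 * (k%:R - n%:R * x) ^+ 2.
  move=> kn; have k01 : 0 <= (k%:R / n%:R : R) <= 1.
    by rewrite divr_ge0 //= ler_pdivrMr // mul1r ler_nat.
  have -> : b / n%:R ^+ 2 * (k%:R - n%:R * x) ^+ 2 = b * (k%:R / n%:R - x) ^+ 2.
    by field; rewrite gt_eqF.
  have [h|h] := ltP `|x - k%:R / n%:R| d.
    rewrite distrC; apply: le_trans (hd _ _ x01 h) _.
    by rewrite lerDl mulr_ge0 ?sqr_ge0 // ltW.
  apply: le_trans (_ : 2 * K <= _).
    by apply: le_trans (ler_normB _ _) _; have := hK _ k01; have := hK _ x01; lra.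
  have : 2 * K <= b * (k%:R / n%:R - x) ^+ 2.
    rewrite /b mulrAC ler_pdivlMr ?exprn_gt0 // ler_pM2l ?mulr_gt0 //.
    rewrite -[leRHS]real_normK ?num_real // distrC ler_sqr ?nnegrE //.
    exact: ltW.
  by lra.
have tail : e / 2 + b / n%:R ^+ 2 * (n%:R * x * (1 - x) + (n%:R * x - n%:R * x) ^+ 2) <= e.
  rewrite subrr expr0n /= addr0.
  have -> : b / n%:R ^+ 2 * (n%:R * x * (1 - x)) = b / n%:R * (x * (1 - x)).
    by field; rewrite gt_eqF.
  have xx : x * (1 - x) <= 1 by case/andP: x01 => ? ?; nra.
  have bn : 0 <= b / n%:R by rewrite divr_ge0 // ltW.
  have := ler_wpM2l bn xx; rewrite mulr1; lra.
(* The lower and the upper estimate apply the monotone expectation to a quadratic minorant and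
   majorant of k -> f(k/n). *)
rewrite ler_norml; apply/andP; split.
  rewrite lerBrDr addrC -lerBrDr opprK.
  pose w k := f x + - (e / 2) + (- (b / n%:R ^+ 2)) * (k%:R - n%:R * x) ^+ 2.
  have : (bernstein w n).[x] <= (bernstein (fun k => f (k%:R / n%:R)) n).[x].
    apply: bernstein_le => // k kn; have := hk k kn; rewrite ler_norml /w; lra.
  by rewrite bernstein_affine bernstein_variance; lra.
rewrite lerBlDr.
pose w k := f x + e / 2 + (b / n%:R ^+ 2) * (k%:R - n%:R * x) ^+ 2.
have : (bernstein (fun k => f (k%:R / n%:R)) n).[x] <= (bernstein w n).[x].
  apply: bernstein_le => // k kn; have := hk k kn; rewrite ler_norml /w; lra.
by rewrite bernstein_affine bernstein_variance; lra.
Qed.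

Lemma weierstrass f M e : continuous f -> 0 < M -> 0 < e ->
  exists p : {poly R}, forall x, 0 <= x <= M -> `|p.[x] - f x| <= e.
Proof.
move=> cf M0 e0; have cg : continuous (fun x => f (M * x)).
  move=> x; apply: (continuous_comp _ (cf _)).
  by apply: continuousM; [exact: cst_continuous | exact: cvg_id].
have [p hp] := weierstrass01 cg e0; exists (p \Po (M^-1 *: 'X)) => x /andP[x0 xM].
rewrite horner_comp hornerZ hornerX.
have := hp (M^-1 * x); rewrite mulVKf ?gt_eqF //; apply.
by rewrite mulr_ge0 ?invr_ge0 ?(ltW M0) //= ler_pdivrMl ?mulr1.
Qed.

Lemma within_bounded (A : set R) f M : closed A ->
  (forall x, A x -> 0 <= x <= M) -> {within A, continuous f} ->
  exists2 N : R, 0 < N & forall x, A x -> `|f x| <= N.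
Proof.
move=> clA AM cf; have cptA : compact A.
  apply: subclosed_compact clA (@segment_compact R 0 M) _ => x /AM.
  by rewrite /= in_itv.
have /compact_bounded[N [_ hN]] : compact (f @` A) by exact: continuous_compact.
exists (`|N| + 1) => [|x Ax]; first by rewrite ltr_wpDl.
apply: hN; last by exists x.
by rewrite ltr_pwDr // ler_norm.
Qed.

Lemma weierstrass_within (A : set R) f M e : 0 < M -> 0 < e -> closed A ->
  (forall x, A x -> 0 <= x <= M) -> {within A, continuous f} ->
  exists p : {poly R}, forall x, A x -> `|p.[x] - f x| <= e.
Proof.
move=> M0 e0 clA AM cf; have [N N0 bf] := within_bounded clA AM cf.
(* Tietze's theorem extends f from the closed set A to the whole line. *)
have [g [fg cg _]] :=
  continuous_bounded_extension (@pseudometric_normal R R) clA N0 cf bf.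
have [p hp] := weierstrass cg M0 e0; exists p => x Ax.
by rewrite fg ?inE //; apply: hp; exact: AM.
Qed.

End Weierstrass.

(** * Continuous functional calculus *)

Section FunctionalCalculus.
Variables (R : realType) (H : qhilbertType R).
Implicit Types (S T : bop H) (x y : H) (a c s e : R) (f g : R -> R).
Implicit Types (p q : {poly R}).
Local Notation "c %:O" := (c *: (1 : bop H)) (format "c %:O").

Lemma bop_upper T : adj T T -> exists2 M : R, 0 < M & T <=o M%:O.
Proof.
by move=> aT; have [M M0 hM] := bop_bound T; exists M => //; apply: opnorm_ople.
Qed.

Lemma rspectrum_itv T M s : pos T -> T <=o M%:O -> rspectrum T s -> 0 <= s <= M.
Proof.
move=> pT TM sT; rewrite (rspectrum_le pT.1 TM sT) andbT.
apply: (rspectrum_ge pT.1 _ sT).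
by rewrite scale0r ople0.
Qed.

(** S is f(T): polynomials approximate f on the spectrum and S in norm at the same time. The
    function [fc] is chosen from this relation once existence and uniqueness are known. *)
Definition represents T f S := forall e, 0 < e -> exists2 p,
  forall s, rspectrum T s -> `|p.[s] - f s| <= e & opnorm_le (S - peval T p) e.

(** Approximating polynomials differ by at most c + 2 d on the spectrum, so S' and S differ by at
    most c + 4 d. Uniqueness and continuity of the calculus both follow. *)
Lemma represents_dist T f g S S' c : adj T T -> 0 <= c ->
  represents T f S -> represents T g S' ->
  (forall s, rspectrum T s -> `|g s - f s| <= c) -> opnorm_le (S' - S) c.
Proof.
move=> aT c0 hf hg fg x; apply/ler_addgt0Pr => e e0.
(* With d = e / k, the four errors d cost at most e at x. *)
pose k := 4 * (qnorm x + 1); have k0 : 0 < k.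
  by rewrite mulr_gt0 // ltr_wpDl ?qnorm_ge0.
pose d := e / k; have d0 : 0 < d by rewrite divr_gt0.
have [p hp Sp] := hf d d0; have [q hq Sq] := hg d d0.
have npq : opnorm_le (peval T (q - p)) (c + d + d).
  apply: peval_opnorm => // [|s sT]; first by rewrite !ltr_wpDl // addr_ge0 // ltW.
  have := fg s sT; have := hp s sT; have := hq s sT.
  by rewrite hornerD hornerN !ler_norml => /andP[? ?] /andP[? ?] /andP[? ?];
    apply/andP; split; lra.
have -> : S' - S = (S' - peval T q) + peval T (q - p) + - (S - peval T p).
  by rewrite pevalB addrA subrK opprB addrA subrK.
have := opnormD (opnormD Sq npq) (opnormN Sp) x.
move=> /le_trans; apply.
have -> : d + (c + d + d) + d = c + 4 * d by ring.
rewrite mulrDl lerD2l; have -> : e = d * k by rewrite divfK // gt_eqF.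
by rewrite /k; lra.
Qed.

Lemma represents_uniq T f S S' : adj T T ->
  represents T f S -> represents T f S' -> S' = S.
Proof.
move=> aT h h'; apply: (@opnorm_eq _ _ _ _ 1) => e e0; rewrite mulr1.
apply: opnorm_le_trans (ltW e0) _.
by apply: (represents_dist aT _ h h') => // s _; rewrite subrr normr0.
Qed.

Lemma represents_ext T f g S : (forall s, rspectrum T s -> f s = g s) ->
  represents T f S -> represents T g S.
Proof.
move=> fg h e e0; have [p hp Sp] := h e e0; exists p => // s sT.
by rewrite -fg //; apply: hp.
Qed.

Lemma represents_poly T p : represents T (horner p) (peval T p).
Proof.
move=> e e0; exists p => [s _|x]; first by rewrite subrr normr0 ltW.
by rewrite subrr bop0E qnorm0 mulr_ge0 ?qnorm_ge0 ?ltW.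
Qed.

Lemma representsD T f g S S' : represents T f S -> represents T g S' ->
  represents T (f \+ g) (S + S').
Proof.
move=> hf hg e e0; have e2 : 0 < e / 2 by rewrite divr_gt0.
have [p hp Sp] := hf _ e2; have [q hq Sq] := hg _ e2.
exists (p + q) => [s sT|].
  rewrite hornerD /= opprD addrACA; apply: le_trans (ler_normD _ _) _.
  by have := hp s sT; have := hq s sT; lra.
by rewrite pevalD opprD addrACA [e]splitr; apply: opnormD.
Qed.

Lemma representsZ T f S a : represents T f S ->
  represents T (fun s => a * f s) (a *: S).
Proof.
move=> hf e e0; have a0 : 0 < `|a| + 1 by rewrite ltr_wpDl.
have [p hp Sp] := hf _ (divr_gt0 e0 a0).
have small : `|a| * (e / (`|a| + 1)) <= e.
  by rewrite mulrA ler_pdivrMr // mulrC ler_pM2l // lerDl.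
exists (a *: p) => [s sT|].
  rewrite hornerZ -mulrBr normrM; apply: le_trans small.
  by apply: ler_wpM2l => //; exact: hp.
by rewrite pevalZ -scalerBr; apply: opnorm_le_trans small _; apply: opnormZ.
Qed.

Lemma representsM T f g S S' K K' :
  (forall s, rspectrum T s -> `|f s| <= K) ->
  (forall s, rspectrum T s -> `|g s| <= K') -> 0 < K -> 0 < K' ->
  represents T f S -> represents T g S' -> represents T (f \* g) (S * S').
Proof.
move=> fK gK K0 K'0 hf hg e e0.
have [c c0 hc] := bop_bound S; have [c' c'0 hc'] := bop_bound S'.
(* For d <= 1 the error is at most d (K + K' + 1) on the spectrum and d (c + c' + 1) in norm, both
   at most d D. *)
pose D := K + K' + 1 + c + c'; have D0 : 0 < D by rewrite /D; lra.
have De : 0 < D + e by lra.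
pose d := e / (D + e); have d0 : 0 < d by rewrite divr_gt0.
have d1 : d <= 1 by rewrite ler_pdivrMr // mul1r lerDr ltW.
have dD : d * D <= e by rewrite mulrAC ler_pdivrMr // ler_pM2l // lerDl ltW.
have [p hp Sp] := hf d d0; have [q hq Sq] := hg d d0.
exists (p * q) => [s sT|].
  rewrite hornerM /=.
  have -> : p.[s] * q.[s] - f s * g s =
    (p.[s] - f s) * (q.[s] - g s) + (f s * (q.[s] - g s) + (p.[s] - f s) * g s).
    by ring.
  have h1 := hp s sT; have h2 := hq s sT; have h3 := fK s sT; have h4 := gK s sT.
  apply: le_trans (ler_normD _ _) _.
  have := ler_normD (f s * (q.[s] - g s)) ((p.[s] - f s) * g s); rewrite !normrM.
  have := ler_pM (normr_ge0 _) (normr_ge0 _) h1 h2.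
  have := ler_pM (normr_ge0 _) (normr_ge0 _) h3 h2.
  have := ler_pM (normr_ge0 _) (normr_ge0 _) h1 h4.
  move: dD; rewrite /D; nra.
have -> : S * S' - peval T (p * q) = (S - peval T p) * S' + S * (S' - peval T q)
   + - ((S - peval T p) * (S' - peval T q)).
  rewrite pevalM; set P := peval T p; set Q := peval T q.
  have E : S - (S - P) = P by rewrite opprB addrC subrK.
  by rewrite -addrA -mulrBl E mulrBl mulrBr addrA subrK.
have h1 := opnormM (ltW d0) Sp hc'; have h2 := opnormM (ltW c0) hc Sq.
have h3 := opnormN (opnormM (ltW d0) Sp Sq).
apply: opnorm_le_trans (opnormD (opnormD h1 h2) h3).
move: dD; rewrite /D; nra.
Qed.

Lemma spectral_approx T f e : pos T -> spectral_cont T f -> 0 < e ->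
  exists p, forall s, rspectrum T s -> `|p.[s] - f s| <= e.
Proof.
move=> pT cf e0; have [M M0 TM] := bop_upper pT.1.
apply: (@weierstrass_within _ (rspectrum T) _ M) => //.
  exact: closed_rspectrum pT.1.
by move=> s; apply: rspectrum_itv.
Qed.

Lemma spectral_bounded T f : pos T -> spectral_cont T f ->
  exists2 K : R, 0 < K & forall s, rspectrum T s -> `|f s| <= K.
Proof.
move=> pT cf; have [M M0 TM] := bop_upper pT.1.
apply: (@within_bounded _ (rspectrum T) _ M) => //.
  exact: closed_rspectrum pT.1.
by move=> s; apply: rspectrum_itv.
Qed.

Lemma invS_small e : 0 < e -> exists N, forall n, (N <= n)%N -> n.+1%:R^-1 <= e.
Proof.
move=> e0; exists (Num.truncn e^-1) => n Nn.
rewrite -[e]invrK lef_pV2 ?posrE ?invr_gt0 ?ltr0n //.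
apply/ltW; apply: lt_le_trans (truncnS_gt _) _.
by rewrite ler_nat ltnS.
Qed.

(** Polynomials within 1/(n+1) of f on the spectrum yield a Cauchy sequence of operators. *)
Lemma represents_exists T f : pos T -> spectral_cont T f ->
  exists S, represents T f S.
Proof.
move=> pT cf.
have i0 n : 0 < n.+1%:R^-1 :> R by rewrite invr_gt0 ltr0n.
have /choice[P hP] : forall n : nat, exists p, forall s, rspectrum T s ->
    `|p.[s] - f s| <= n.+1%:R^-1.
  by move=> n; apply: spectral_approx.
have [S hS] : exists S, forall e, 0 < e -> exists N, forall n, (N <= n)%N ->
    opnorm_le (peval T (P n) - S) e.
  apply: bop_complete => e e0; have [N hN] := invS_small (divr_gt0 e0 (ltr0Sn R 1)).
  exists N => m n Nm Nn; rewrite -pevalB; apply: peval_opnorm => // [|s sT].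
    exact: pT.1.
  have := hP m s sT; have := hP n s sT; have := hN m Nm; have := hN n Nn.
  have -> : (P m - P n).[s] = ((P m).[s] - f s) - ((P n).[s] - f s).
    by rewrite hornerD hornerN; ring.
  move=> hn hm Hn Hm; apply: le_trans (ler_normB _ _) _.
  rewrite [e]splitr; apply: lerD; first exact: le_trans Hm hm.
  exact: le_trans Hn hn.
exists S => e e0; have [N hN] := hS e e0; have [N' hN'] := invS_small e0.
exists (P (maxn N N')) => [s sT|].
  by apply: le_trans (hP _ s sT) _; apply: hN'; rewrite leq_maxr.
by rewrite -opprB; apply: opnormN; apply: hN; rewrite leq_maxl.
Qed.

Definition fc T f : bop H := xget 0 [set S | represents T f S].

Lemma fcP T f : pos T -> spectral_cont T f -> represents T f (fc T f).
Proof. by move=> pT /(represents_exists pT)[S hS]; apply: (xgetPex 0); exists S. Qed.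

Lemma fc_uniq T f S : pos T -> represents T f S -> fc T f = S.
Proof.
move=> pT hS; apply: (represents_uniq pT.1 hS).
by apply: (xgetPex 0); exists S.
Qed.

End FunctionalCalculus.

(** * Agreement with the specified calculus; algebra, order and composition *)

Section CalculusOfPositive.
Variables (R : realType) (H : qhilbertType R).
Implicit Types (S T : bop H) (x y : H) (a c s e : R) (f g : R -> R).
Implicit Types (p q : {poly R}).
Local Notation "c %:O" := (c *: (1 : bop H)) (format "c %:O").

Lemma represents_cst T a : represents T (fun=> a) a%:O.
Proof.
rewrite -(pevalC T); apply: represents_ext (represents_poly _ _) => s _.
by rewrite hornerC.
Qed.

Lemma represents_id T : represents T idfun T.
Proof.
rewrite -{2}(pevalX T); apply: represents_ext (represents_poly _ _) => s _.
by rewrite hornerX.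
Qed.

(** A functional calculus exists, so the choice in [cfc] does not return its junk value. *)
Lemma fc_is_cfc T : pos T -> is_cfc T (fun f => fc T f).
Proof.
move=> pT; have rP f := @fcP R H T f pT; have rU f S := @fc_uniq R H T f S pT.
split.
- by move=> f _; exact: bop_fun_bounded.
- move=> f g cf cg fg; congr bop_fun; apply/esym/rU.
  by apply: represents_ext (rP f cf).
- by rewrite (rU _ _ (represents_cst T 1)) scale1r.
- by move=> f g cf cg; rewrite (rU _ _ (representsD (rP f cf) (rP g cg))).
- by move=> a f cf; rewrite (rU _ _ (representsZ a (rP f cf))).
- move=> f g cf cg; have [K K0 fK] := spectral_bounded pT cf.
  have [K' K'0 gK'] := spectral_bounded pT cg.
  by rewrite (rU _ _ (representsM fK gK' K0 K'0 (rP f cf) (rP g cg))).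
- by rewrite (rU _ _ (represents_id T)).
- move=> f cf e e0; exists e => // g cg fg x.
  exact: (represents_dist pT.1 (ltW e0) (rP f cf) (rP g cg) fg).
Qed.

Lemma continuous_spectral_cont T f : continuous f -> spectral_cont T f.
Proof. exact: continuous_subspaceT. Qed.

Lemma cfc_poly T Phi p : is_cfc T Phi -> Phi (horner p) = peval T p :> (H -> H).
Proof.
move=> cP; have sc q : spectral_cont T (horner q).
  by apply: continuous_spectral_cont; exact: continuous_horner.
have sid : spectral_cont T idfun.
  by apply: continuous_spectral_cont => x; exact: cvg_id.
have s1 a : spectral_cont T (fun=> a).
  by apply: continuous_spectral_cont; exact: cst_continuous.
elim/poly_ind: p => [|p c IH].
  have -> : horner (0 : {poly R}) = (fun s => 0 * (fun=> 1) s).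
    by apply/funext => s; rewrite horner0 mul0r.
  rewrite (cfc_scale cP) // (cfc_unit cP) -[0 in RHS]polyC0 pevalC.
  by apply/funext.
have -> : horner (p * 'X + c%:P) = (horner p \* idfun) \+ (fun s => c * (fun=> 1) s).
  by apply/funext => s; rewrite /= !hornerE.
have sp : spectral_cont T (horner p \* idfun).
  have -> : horner p \* idfun = horner (p * 'X) by apply/funext => s; rewrite !hornerE.
  exact: sc.
rewrite (cfc_add cP) //.
rewrite (cfc_mul cP) // (cfc_scale cP) // (cfc_unit cP) (cfc_id cP) IH.
by rewrite pevalD pevalMX pevalC.
Qed.

(** Uniqueness: every functional calculus agrees with [peval] on polynomials, which are dense, and
    is continuous. *)
Lemma cfc_fc T f : pos T -> spectral_cont T f -> cfc T f = fc T f.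
Proof.
move=> pT cf; have cP : is_cfc T (cfc T).
  by apply: (xgetPex _ (P := [set Phi | is_cfc T Phi])); eexists; exact: fc_is_cfc pT.
rewrite (@fc_uniq _ _ T f (Bop (cfc_bounded cP cf))) // => e e0.
have [d d0 hd] := cfc_continuous cP cf e0.
(* The same polynomial must be within e of f and within the continuity threshold d of the chosen
   calculus. *)
pose e' := Num.min d e; have e'0 : 0 < e' by rewrite lt_min d0.
have [p hp] := spectral_approx pT cf e'0; exists p.
  by move=> s sT; apply: le_trans (hp s sT) _; rewrite ge_min lexx orbT.
rewrite -[X in opnorm_le X]opprB; apply: opnormN => x.
rewrite bopDE bopNE /= -(cfc_poly p cP); apply: hd.
  by apply: continuous_spectral_cont; exact: continuous_horner.
by move=> s sT; apply: le_trans (hp s sT) _; rewrite ge_min lexx.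
Qed.

Variables (T : bop H) (pT : pos T).

Lemma fc_rep f : continuous f -> represents T f (fc T f).
Proof. by move=> cf; apply: fcP => //; exact: continuous_spectral_cont. Qed.

Lemma fc_ext f g : continuous f -> (forall s, rspectrum T s -> f s = g s) ->
  fc T g = fc T f.
Proof.
by move=> cf fg; apply: fc_uniq => //; apply: represents_ext (fc_rep cf).
Qed.

Lemma fcD f g : continuous f -> continuous g ->
  fc T (f \+ g) = fc T f + fc T g.
Proof. by move=> cf cg; apply: fc_uniq => //; apply: representsD; exact: fc_rep. Qed.

Lemma fcZ a f : continuous f -> fc T (fun s => a * f s) = a *: fc T f.
Proof. by move=> cf; apply: fc_uniq => //; apply: representsZ; exact: fc_rep. Qed.

Lemma fcM f g : continuous f -> continuous g ->
  fc T (f \* g) = fc T f * fc T g.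
Proof.
move=> cf cg; apply: fc_uniq => //.
have [K K0 fK] := spectral_bounded pT (@continuous_spectral_cont T f cf).
have [K' K'0 gK'] := spectral_bounded pT (@continuous_spectral_cont T g cg).
exact: (representsM fK gK' K0 K'0 (fc_rep cf) (fc_rep cg)).
Qed.

Lemma fc_cst a : fc T (fun=> a) = a%:O.
Proof. by apply: fc_uniq => //; exact: represents_cst. Qed.

Lemma fc_id : fc T idfun = T.
Proof. by apply: fc_uniq => //; exact: represents_id. Qed.

Lemma fc_adj f : continuous f -> adj (fc T f) (fc T f).
Proof.
move=> cf; apply: (@adj_lim _ _ _ 1) => e e0.
have [p _ hp] := fc_rep cf e0; exists (peval T p); first exact: peval_adj pT.1.
by rewrite mulr1.
Qed.

(** If p is within e/2 of f on the spectrum, then p + e/2 is nonnegative there and f(T) >= p(T) -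
    e/2. *)
Lemma fc_pos f : continuous f -> (forall s, rspectrum T s -> 0 <= f s) ->
  pos (fc T f).
Proof.
move=> cf f0; rewrite -ople0; apply: (@ople_lim _ _ _ _ 1%:O).
- move=> e e0; have e2 : 0 < e / 2 by rewrite divr_gt0.
  have [p hp Sp] := fc_rep cf e2.
  have ap := peval_adj p pT.1; have aS := fc_adj cf.
  have h1 : pos (peval T (p + (e / 2)%:P)).
    apply: peval_pos => [|s sT]; first exact: pT.1.
    have := hp s sT; have := f0 s sT; rewrite ler_norml hornerD hornerC; lra.
  have h2 : pos (fc T f - peval T p + (e / 2)%:O).
    rewrite addrC -[X in _ + X]opprK.
    apply: opnorm_ople (opnormN Sp); apply: adjN; exact: adjB.
  have := pos_add h2 h1; rewrite pevalD pevalC addrACA -scalerDl -splitr subrK.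
  by rewrite ople0 [e *: _]scalerA mulr1.
- exact: adj0.
- exact: fc_adj.
Qed.

Lemma fc_le f g : continuous f -> continuous g ->
  (forall s, rspectrum T s -> f s <= g s) -> fc T f <=o fc T g.
Proof.
move=> cf cg fg.
have cN : continuous (fun s => -1 * f s).
  by move=> s; apply: continuousM (cf s); exact: cst_continuous.
have cB : continuous (g \+ (fun s => -1 * f s)).
  by move=> s; apply: continuousD (cg s) (cN s).
have : pos (fc T (g \+ (fun s => -1 * f s))).
  by apply: fc_pos => // s sT /=; rewrite mulN1r subr_ge0 fg.
by rewrite fcD // fcZ // scaleN1r.
Qed.

Lemma fc_poly p : fc T (horner p) = peval T p.
Proof. by apply: fc_uniq => //; exact: represents_poly. Qed.

Lemma fc_comp_poly p g : continuous g -> fc T (fun s => p.[g s]) = peval (fc T g) p.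
Proof.
move=> cg; elim/poly_ind: p => [|p c IH].
  have -> : (fun s => (0 : {poly R}).[g s]) = (fun=> 0).
    by apply/funext => s; rewrite horner0.
  by rewrite fc_cst -[0 in RHS]polyC0 pevalC.
have -> : (fun s => (p * 'X + c%:P).[g s]) =
    ((fun s => p.[g s]) \* g) \+ (fun=> c).
  by apply/funext => s; rewrite !hornerE.
have cp : continuous (fun s => p.[g s]).
  by move=> s; apply: (continuous_comp (cg s)); exact: continuous_horner.
have cpg : continuous ((fun s => p.[g s]) \* g).
  by move=> s; apply: continuousM (cp s) (cg s).
by rewrite fcD ?fcM ?IH ?fc_cst ?pevalD ?pevalMX ?pevalC //; exact: cst_continuous.
Qed.

(** The interval [0, M] contains both the spectrum of g(T) and the values of g on the spectrum of T,
    so one polynomial approximating f on it serves both sides. *)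
Lemma fc_comp f g : continuous f -> continuous g ->
  (forall s, rspectrum T s -> 0 <= g s) ->
  fc (fc T g) f = fc T (fun s => f (g s)).
Proof.
move=> cf cg g0; have pG := fc_pos cg g0.
apply: fc_uniq => // e e0.
have [M1 M10 GM] := bop_upper pG.1.
have [M2 M20 gM] := spectral_bounded pT (@continuous_spectral_cont T g cg).
pose M := M1 + M2; have M0 : 0 < M by rewrite addr_gt0.
have [p hp] := weierstrass cf M0 e0; exists p => [s sG|].
  apply: hp; have /andP[-> sM] := rspectrum_itv pG GM sG.
  by rewrite (le_trans sM) // lerDl ltW.
rewrite -fc_comp_poly //.
apply: (represents_dist pT.1 (ltW e0) (fc_rep _) (fc_rep _)).
- by move=> s; apply: (continuous_comp (cg s)); exact: continuous_horner.
- by move=> s; apply: (continuous_comp (cg s)); exact: cf.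
move=> s sT; rewrite distrC; apply: hp; rewrite g0 //=.
by apply: le_trans (ler_norm _) _; apply: le_trans (gM s sT) _; rewrite lerDr ltW.
Qed.

End CalculusOfPositive.

(** * Passing from functions of C D to functions of D C *)

Section SwapCalculus.
Variables (R : realType) (H : qhilbertType R).
Implicit Types (C D : bop H).

(** Extends (D C)^(n+1) = D (C D)^n C linearly. *)
Lemma peval_swap C D p :
  peval (D * C) (p * 'X) = D * peval (C * D) p * C.
Proof.
elim/poly_ind: p => [|p c IH].
  by rewrite mul0r -[0 in LHS]polyC0 -[0 in RHS]polyC0 !pevalC !scale0r mulr0 mul0r.
rewrite pevalMX 2!pevalD IH !pevalC pevalMX.
rewrite mulrDl mulrDr mulrDl -!mulrA; congr (_ + _).
by rewrite -!bop_scalerAl !mul1r bop_scalerAr.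
Qed.

Lemma fc_swap C D (h : R -> R) : adj C D -> continuous h ->
  fc (D * C) (fun s => h s * s) = D * fc (C * D) h * C.
Proof.
move=> aCD ch; have p1 : pos (D * C) := pos_adjM aCD.
have p2 : pos (C * D) := pos_adjM (adjC aCD).
apply: fc_uniq => // e e0.
have [M1 M10 hM1] := bop_upper p1.1; have [M2 M20 hM2] := bop_upper p2.1.
have [c c0 hc] := bop_bound C; have [d d0 hd] := bop_bound D.
(* An error e / k in h is multiplied by s <= M1 on the spectrum and by the norms d and c of D and
   C. *)
pose k := M1 + d * c; have k0 : 0 < k by rewrite addr_gt0 ?mulr_gt0.
have e'0 : 0 < e / k by rewrite divr_gt0.
have ek : e = e / k * k by rewrite divfK // gt_eqF.
pose M := M1 + M2; have M0 : 0 < M by rewrite addr_gt0.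
have [p hp] := weierstrass ch M0 e'0.
have hp1 s : rspectrum (D * C) s -> `|p.[s] - h s| <= e / k /\ 0 <= s <= M1.
  move=> sT; have /andP[s0 sM] := rspectrum_itv p1 hM1 sT.
  by split; [apply: hp|]; rewrite s0 //= (le_trans sM) // lerDl ltW.
have hp2 s : rspectrum (C * D) s -> `|p.[s] - h s| <= e / k.
  move=> sT; have /andP[s0 sM] := rspectrum_itv p2 hM2 sT.
  by apply: hp; rewrite s0 //= (le_trans sM) // lerDr ltW.
exists (p * 'X) => [s /hp1[hs /andP[s0 sM]]|].
  rewrite hornerM hornerX -mulrBl normrM (ger0_norm s0) ek.
  apply: ler_pM => //; apply: le_trans sM _.
  by rewrite lerDl mulr_ge0 ?ltW.
rewrite peval_swap -mulrBl -mulrBr -fc_poly //.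
have hn : opnorm_le (fc (C * D) h - fc (C * D) (horner p)) (e / k).
  apply: (represents_dist p2.1 (ltW e'0) (fc_rep p2 _) (fc_rep p2 _)) => //.
    exact: continuous_horner.
  by move=> s sT; rewrite distrC hp2.
have := opnormM _ (opnormM (ltW d0) hd hn) hc.
rewrite mulr_ge0 ?(ltW d0) ?(ltW e'0) // => /(_ isT); apply: opnorm_le_trans.
rewrite {2}ek mulrAC mulrC ler_pM2l // lerDr ltW //.
Qed.

End SwapCalculus.

(** * Powers and the Loewner-Heinz inequality *)

Section PowerFunctions.
Variable R : realType.
Implicit Types (s t x y a b e d : R).

(* Clamping makes [pw t] continuous on the whole line for [t >= 0], whereas
   [powR s t = 1] for [s < 0]. *)
Definition pw t s := powR (Num.max 0 s) t.

Lemma pwE t s : 0 <= s -> pw t s = powR s t.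
Proof. by move=> s0; rewrite /pw max_r. Qed.

Lemma powR_continuous_at x t : 0 < x -> {for x, continuous (fun y : R => powR y t)}.
Proof.
move=> x0; apply: differentiable_continuous; apply/derivable1_diffP.
by apply: derivable_powR; rewrite in_itv /= x0.
Qed.

Lemma max_continuous e : continuous (fun s => Num.max e s).
Proof.
move=> s; apply: (@continuous_max R R^o (fun=> e) idfun); first exact: cst_continuous.
exact: cvg_id.
Qed.

Lemma powR_max_continuous e t : 0 < e -> continuous (fun s => powR (Num.max e s) t).
Proof.
move=> e0 s; apply: (@continuous_comp _ _ _ (Num.max e) (fun y : R => powR y t) s).
  exact: max_continuous.
by apply: powR_continuous_at; rewrite lt_max e0.
Qed.

Lemma pw_ge0 t s : 0 <= pw t s.
Proof. exact: powR_ge0. Qed.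

Lemma powR_le x y t : 0 <= t -> 0 <= x -> x <= y -> powR x t <= powR y t.
Proof.
move=> t0 x0 xy; apply: ge0_ler_powR => //; rewrite nnegrE //.
exact: le_trans xy.
Qed.

Lemma powR_root e t : 0 <= e -> t != 0 -> powR (powR e t^-1) t = e.
Proof. by move=> e0 t0; rewrite -powRrM mulVf // powRr1. Qed.

Lemma pw_continuous t : 0 <= t -> continuous (pw t).
Proof.
rewrite le_eqVlt => /predU1P[<-|t0] s.
  have -> : pw 0 = fun=> 1 by apply/funext => x; rewrite /pw powRr0.
  exact: cst_continuous.
have [s0|s0] := ltP 0 s.
  rewrite /pw.
  apply: (@continuous_comp _ _ _ (Num.max (0 : R)) (fun y : R => powR y t) s).
    exact: max_continuous.
  by apply: powR_continuous_at; rewrite lt_max s0 orbT.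
(* At s <= 0 the value is 0, and [pw t x] is at most e once x < e^(1/t). *)
have E : pw t s = 0 by rewrite /pw max_l // powR0 // gt_eqF.
apply/cvgrPdist_le => e e0; rewrite E.
have d0 : 0 < powR e t^-1 by apply: powR_gt0.
near=> x; rewrite sub0r normrN ger0_norm ?pw_ge0 //.
rewrite -(powR_root (ltW e0) (lt0r_neq0 t0)) /pw.
apply: powR_le; [exact: ltW|by rewrite le_max lexx|].
rewrite ge_max ltW //=; apply: ltW; near: x.
by apply: lt_nbhsl; apply: le_lt_trans s0 d0.
Unshelve. all: by end_near. Qed.

Lemma powRD_ge0 x a b : 0 <= a -> 0 <= b -> powR x (a + b) = powR x a * powR x b.
Proof.
move=> a0 b0; have [ab|ab] := eqVneq (a + b) 0; last first.
  by apply: powRD; rewrite (negPf ab).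
have [-> ->] : a = 0 /\ b = 0 by split; lra.
by rewrite addr0 !powRr0 mulr1.
Qed.

(** Write (x + e)^t = x (x + e)^(t-1) + e (x + e)^(t-1) and use that s^(t-1) decreases. *)
Lemma powR_subadd x e t : 0 <= x -> 0 < e -> 0 < t -> t <= 1 ->
  powR (x + e) t <= powR x t + powR e t.
Proof.
move=> x0 e0 t0 t1; have xe : 0 < x + e by lra.
have pos_t1 y z : 0 < y -> y <= z -> powR z (t - 1) <= powR y (t - 1).
  move=> y0 yz; have z0 : 0 < z by lra.
  have -> : t - 1 = - (1 - t) by ring.
  rewrite !powRN lef_pV2 ?posrE ?powR_gt0 //.
  by apply: powR_le => //; [lra | exact: ltW].
have E y : 0 <= y -> powR y t = y * powR y (t - 1).
  by move=> y0; rewrite mulr_powRB1.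
rewrite (E _ (ltW xe)) mulrDl; apply: lerD.
  move: x0; rewrite le_eqVlt => /predU1P[<-|x0].
    by rewrite mul0r powR_ge0.
  rewrite (E _ (ltW x0)) ler_pM2l //.
  by apply: pos_t1 => //; lra.
rewrite (E _ (ltW e0)) ler_pM2l //.
by apply: pos_t1 => //; lra.
Qed.

(** Bounds the error of damping s^(-b) to 1/(s^b + d). For y <= e the quotient is at most y; for y >
    e it is at most M d / e^b, which is e for the chosen d. *)
Lemma damped_small M b e : 0 < M -> 0 <= b -> 0 < e ->
  exists2 d, 0 < d & forall y, 0 <= y <= M -> y * d / (powR y b + d) <= e.
Proof.
move=> M0 b0 e0; have eb : 0 < powR e b := powR_gt0 _ e0.
exists (e * powR e b / M); first by rewrite divr_gt0 // mulr_gt0.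
set d := _ / M => y /andP[y0 yM]; have d0 : 0 < d by rewrite divr_gt0 // mulr_gt0.
have n0 : 0 < powR y b + d by rewrite ltr_wpDl ?powR_ge0.
rewrite ler_pdivrMr //; have [ye|ey] := leP y e.
  have := powR_ge0 y b; nra.
have h : powR e b <= powR y b by apply: powR_le; rewrite // ltW.
have dM : d * M = e * powR e b by rewrite /d divfK // gt_eqF.
nra.
Qed.

End PowerFunctions.

(** * The norm of a selfadjoint operator from its powers *)

Section SpectralRadius.
Variables (R : realType) (H : qhilbertType R).
Implicit Types (S T C D : bop H).
Local Notation "c %:O" := (c *: (1 : bop H)) (format "c %:O").

(** If z < y, then (z / y)^n falls below 1 / (2 K) for large n. *)
Lemma expr2k_le (y z K : R) : 0 <= y -> 0 <= z -> 0 < K ->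
  (forall k, y ^+ (2 ^ k) <= K * z ^+ (2 ^ k)) -> y <= z.
Proof.
move=> y0 z0 K0 h; rewrite leNgt; apply/negP => zy.
have y_gt0 : 0 < y := le_lt_trans z0 zy.
have r01 : 0 <= z / y < 1 by rewrite divr_ge0 //= ltr_pdivrMr // mul1r.
have K2 : 0 < (2 * K)^-1 by rewrite invr_gt0 mulr_gt0.
have [N hN] := expr_small r01 K2.
have := hN (2 ^ N)%N (ltnW (ltn_expl N (isT : (1 < 2)%N))); have := h N.
rewrite expr_div_n; set a := y ^+ _; set b := z ^+ _ => h1.
have a0 : 0 < a by rewrite exprn_gt0.
rewrite ler_pdivrMr // mulrC ler_pdivlMr ?mulr_gt0 // => h2.
nra.
Qed.

(* [S] is selfadjoint, so its norm is its spectral radius. *)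
Lemma adj_power_bounded S (c K : R) : adj S S -> 0 < c -> 0 < K ->
  (forall n, opnorm_le (S ^+ n) (K * c ^+ n)) -> opnorm_le S c.
Proof.
move=> aS c0 K0 h x; have [->|x0] := eqVneq x 0.
  by rewrite bop0 qnorm0 mulr0.
have x_gt0 : 0 < qnorm x.
  by rewrite lt_def qnorm_ge0 andbT; apply: contra x0 => /eqP/qnorm_eq0 ->.
have sq T : adj T T -> qnorm (T x) ^+ 2 <= qnorm ((T * T) x) * qnorm x.
  by move=> aT; rewrite sqr_qnorm -aT bopME; exact: rdot_le.
(* Iterates |T x|^2 <= |T^2 x| |x| along T = S^(2^k). The growth bound on S^(2^k) then compares |S
   x| with c |x|. *)
have P k : qnorm (S x) ^+ (2 ^ k) * qnorm x <=
    qnorm ((S ^+ (2 ^ k)) x) * qnorm x ^+ (2 ^ k).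
  elim: k => [|k IH]; first by rewrite expn0 !expr1.
  have := sq _ (adjX (2 ^ k) aS); rewrite -exprD addnn -mul2n -expnS.
  set n := (2 ^ k)%N in IH *; set m := (2 ^ k.+1)%N.
  have mE : m = (n * 2)%N by rewrite /m expnS mulnC.
  have E2 (w : R) : w ^+ m = (w ^+ n) ^+ 2 by rewrite mE exprM.
  move=> h2; rewrite -(ler_pM2r x_gt0) !E2.
  set a := qnorm (S x) ^+ n in IH *; set b := qnorm x ^+ n in IH *.
  have a0 : 0 <= a by rewrite exprn_ge0 ?qnorm_ge0.
  have b0 : 0 <= b by rewrite exprn_ge0 ?qnorm_ge0.
  have ax : 0 <= a * qnorm x by rewrite mulr_ge0 ?qnorm_ge0.
  have := ler_pM ax ax IH IH.
  have := ler_wpM2r (sqr_ge0 b) h2.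
  set u := qnorm ((S ^+ n) x); set v := qnorm ((S ^+ m) x) => h3 h4.
  have -> : a ^+ 2 * qnorm x * qnorm x = a * qnorm x * (a * qnorm x) by ring.
  apply: le_trans h4 _; have -> : u * b * (u * b) = u ^+ 2 * b ^+ 2 by ring.
  by apply: le_trans h3 _; rewrite mulrAC.
apply: (@expr2k_le _ _ K) => // [||k]; rewrite ?qnorm_ge0 ?mulr_ge0 ?(ltW c0) ?qnorm_ge0 //.
rewrite -(ler_pM2r x_gt0) exprMn; apply: le_trans (P k) _.
have := ler_wpM2r (exprn_ge0 (2 ^ k) (qnorm_ge0 x)) (h (2 ^ k)%N x).
by move=> /le_trans; apply; rewrite !mulrA mulrAC.
Qed.

(** |D x|^2 = <C D x, x> <= c |D x| |x|. *)
Lemma opnorm_adj C D (c : R) : 0 <= c -> adj C D -> opnorm_le C c -> opnorm_le D c.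
Proof.
move=> c0 a h x; have [y0|y0] := eqVneq (qnorm (D x)) 0.
  by rewrite y0 mulr_ge0 ?qnorm_ge0.
have y_gt0 : 0 < qnorm (D x) by rewrite lt_def y0 qnorm_ge0.
rewrite -(ler_pM2r y_gt0) -expr2 sqr_qnorm -a.
apply: le_trans (rdot_le _ _) _.
by rewrite mulrAC ler_wpM2r ?qnorm_ge0 // h.
Qed.

End SpectralRadius.

(** * Loewner-Heinz for operators bounded below by e > 0 *)

Section LoewnerHeinzBounded.
Variables (R : realType) (H : qhilbertType R) (e : R) (e0 : 0 < e).
Local Notation "c %:O" := (c *: (1 : bop H)) (format "c %:O").
Implicit Types (a b t : R).

(** Clamping at e makes negative powers continuous on the line and changes nothing on the spectrum
    of an operator >= e. *)
Local Notation E t := (fun s => powR (Num.max e s) t).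
Local Notation "T ^[ t ]" := (fc T (E t)) (at level 30, format "T ^[ t ]").

Let maxe_gt0 s : 0 < Num.max e s. Proof. by rewrite lt_max e0. Qed.
Let cE t : continuous (E t). Proof. exact: powR_max_continuous. Qed.

Section OnePositive.
Variables (X : bop H) (pX : pos X) (eX : e%:O <=o X).

Lemma epowD a b : X^[a + b] = X^[a] * X^[b].
Proof.
rewrite -fcM //; congr fc; apply/funext => s /=.
by apply: powRD; apply/implyP => _; rewrite gt_eqF.
Qed.

Lemma epow0 : X^[0] = 1.
Proof.
have -> : E 0 = fun=> 1 by apply/funext => s; rewrite powRr0.
by rewrite fc_cst // scale1r.
Qed.

Lemma epowNK a : X^[- a] * X^[a] = 1.
Proof. by rewrite -epowD addNr epow0. Qed.

Lemma epowKN a : X^[a] * X^[- a] = 1.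
Proof. by rewrite -epowD subrr epow0. Qed.

Lemma epow1 : X^[1] = X.
Proof.
rewrite -[RHS](fc_id pX); apply/esym/fc_ext => // s sX.
have es : e <= s := rspectrum_ge pX.1 eX sX.
by rewrite max_r // powRr1 // (le_trans _ es) // ltW.
Qed.

Lemma epow_adj a : adj (X^[a]) (X^[a]). Proof. exact: fc_adj. Qed.

Lemma epow_pos a : pos (X^[a]).
Proof. by apply: fc_pos => // s _; exact: powR_ge0. Qed.

Lemma epow_half a : X^[a / 2] * X^[a / 2] = X^[a].
Proof. by rewrite -epowD -splitr. Qed.

End OnePositive.

Variables (X Y : bop H) (pX : pos X) (pY : pos Y).
Hypothesis (eX : e%:O <=o X) (eY : e%:O <=o Y) (YX : Y <=o X).

(** The squared norm at x is <X^(-a/2) Y^a X^(-a/2) x, x> <= c |x|^2. *)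
Lemma epow_contraction a (c : R) : 0 < c -> Y^[a] <=o c *: X^[a] ->
  opnorm_le (Y^[a / 2] * X^[- (a / 2)]) (Num.sqrt c).
Proof.
move=> c0 h x; apply: qnorm_le; first by rewrite mulr_ge0 ?qnorm_ge0 ?sqrtr_ge0.
rewrite exprMn sqr_sqrtr ?(ltW c0) // sqr_qnorm !bopME (epow_adj pY) -bopME.
rewrite epow_half // rdotC; apply: le_trans (opleE _ h) _.
rewrite bopZE rdotZl -(epow_half pX) bopME (epow_adj pX) -!bopME epowKN //.
Qed.

(** With g = (a + b)/2, W = (X^(-a/2) Y^(a/2)) (Y^(b/2) X^(-b/2)) has norm at most sqrt c. The
    selfadjoint S = X^(-g/2) Y^g X^(-g/2) equals X^z W X^(-z), so its powers grow at most like those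
    of sqrt c, and so |S| <= sqrt c. *)
Lemma epow_midpoint a b (c : R) : 0 < c ->
  Y^[a] <=o c *: X^[a] -> Y^[b] <=o 1 *: X^[b] ->
  Y^[(a + b) / 2] <=o Num.sqrt c *: X^[(a + b) / 2].
Proof.
move=> c0 ha hb; have [g gE] : exists g, g = (a + b) / 2 by eexists.
rewrite -gE.
have sc : 0 < Num.sqrt c by rewrite sqrtr_gt0.
have [S SE] : exists S, S = X^[- (g / 2)] * Y^[g] * X^[- (g / 2)] by eexists.
have [W WE] : exists W, W = X^[- (a / 2)] * Y^[g] * X^[- (b / 2)] by eexists.
have [z zE] : exists z, z = (a - b) / 4 by eexists.
have aS : adj S S.
  rewrite SE -[in X in adj _ X]mulrA; apply: adjM; last exact: epow_adj.
  by apply: adjM; exact: epow_adj.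
have nW : opnorm_le W (Num.sqrt c).
  have -> : W = (X^[- (a / 2)] * Y^[a / 2]) * (Y^[b / 2] * X^[- (b / 2)]).
    have Yg : Y^[g] = Y^[a / 2] * Y^[b / 2] by rewrite -epowD // gE mulrDl.
    by rewrite WE Yg; exact/esym/bop_mulA4.
  have -> : Num.sqrt c = Num.sqrt c * Num.sqrt 1 by rewrite sqrtr1 mulr1.
  apply: opnormM; [exact: ltW| |exact: epow_contraction].
  apply: (@opnorm_adj _ _ (Y^[a / 2] * X^[- (a / 2)])); first exact: ltW.
    by apply: adjM; exact: epow_adj.
  exact: epow_contraction.
have SW : S = X^[z] * W * X^[- z].
  have l : X^[- (g / 2)] = X^[z] * X^[- (a / 2)].
    have -> : - (g / 2) = z + - (a / 2) by rewrite zE gE; lra.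
    exact: epowD.
  have r : X^[- (g / 2)] = X^[- (b / 2)] * X^[- z].
    have -> : - (g / 2) = - (b / 2) + - z by rewrite zE gE; lra.
    exact: epowD.
  by rewrite SE WE {1}l r; exact: bop_mulA5.
have [C C0 hC] := bop_bound (X^[z]); have [D D0 hD] := bop_bound (X^[- z]).
have nS : opnorm_le S (Num.sqrt c).
  apply: (@adj_power_bounded _ _ S _ (C * D)) => //; first exact: mulr_gt0.
  move=> n; have -> : S ^+ n = X^[z] * W ^+ n * X^[- z].
    by rewrite SW; apply: bop_similarX; [exact: epowKN|exact: epowNK].
  rewrite [C * D * _]mulrAC; apply: opnormM hD.
    by rewrite mulr_ge0 ?exprn_ge0 ?ltW.
  by apply: opnormM hC _; [exact: ltW | apply: opnormX nW; exact: ltW].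
have := ople_conj (epow_adj pX (g / 2)) (opnorm_ople aS nS).
rewrite SE (bop_conjK _ (epowKN pX _) (epowNK pX _)) bop_conj_scalar.
by rewrite epow_half.
Qed.

Lemma epow_le_approx : exists2 c : R, 0 <= c & forall n t, 0 <= t <= 1 ->
  Y^[t] <=o (1 + c / 2 ^+ n) *: X^[t].
Proof.
have [M M0 YM] := bop_upper pY.1.
(* The initial constant is N / e: Y^t <= N^t <= (N / e) e^t <= (N / e) X^t for t in [0, 1]. *)
pose N := M + e; have eN : 1 <= N / e by rewrite ler_pdivlMr // mul1r /N; lra.
have N0 : 0 < N by rewrite addr_gt0.
exists (N / e - 1); first by rewrite subr_ge0.
elim=> [|n IH] t /andP[t0 t1].
  rewrite expr0 divr1 addrC subrK.
  apply: (@ople_trans _ _ (powR N t)%:O).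
    rewrite -(fc_cst pY); apply: fc_le => // [|s sY]; first exact: cst_continuous.
    apply: powR_le => //; first by rewrite le_max ltW.
    by have := rspectrum_le pY.1 YM sY; rewrite ge_max /N => h; rewrite (le_trans h) ?lerDl ?lerDr ltW//.
  apply: (@ople_trans _ _ ((N / e) * powR e t)%:O).
    apply: opleZl; last exact: pos1.
    have -> : powR N t = powR (N / e) t * powR e t.
      by rewrite -powRM ?divfK ?gt_eqF ?divr_ge0 ?(ltW N0) ?(ltW e0).
    by rewrite ler_wpM2r ?powR_ge0 // ler1_powR.
  rewrite -scalerA; apply: opleZ; first by rewrite (le_trans _ eN).
  rewrite -(fc_cst pX); apply: fc_le => // [|s sX]; first exact: cst_continuous.
  by apply: powR_le => //; [exact: ltW | rewrite le_max lexx].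
have c0 : 0 <= (N / e - 1) / 2 ^+ n by rewrite divr_ge0 ?exprn_ge0 // subr_ge0.
set c := (N / e - 1) / 2 ^+ n in IH c0.
have -> : (N / e - 1) / 2 ^+ n.+1 = c / 2.
  by rewrite /c exprSr invfM mulrA.
have c1 : 0 < 1 + c by lra.
have base : Num.sqrt (1 + c) <= 1 + c / 2.
  rewrite -[leRHS]ger0_norm; last by lra.
  rewrite -sqrtr_sqr ler_sqrt; last exact: sqr_ge0.
  by have := sqr_ge0 c; lra.
have step a b : t = (a + b) / 2 -> Y^[a] <=o (1 + c) *: X^[a] ->
    Y^[b] <=o 1 *: X^[b] -> Y^[t] <=o (1 + c / 2) *: X^[t].
  move=> -> h k; apply: ople_trans (epow_midpoint c1 h k) _.
  by apply: opleZl base (epow_pos _ _).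
(* t is the midpoint of 2 t and 0, or of 2 t - 1 and 1; at the exponents 0 and 1 the inequality
   holds with constant 1. *)
have [t2|t2] := leP t (1 / 2).
  apply: (step (2 * t) 0); [by field|by apply: IH; lra|].
  by rewrite scale1r !epow0 //; exact: ople_refl.
apply: (step (2 * t - 1) 1); [by field|by apply: IH; lra|].
by rewrite scale1r !epow1.
Qed.

Lemma epow_le t : 0 <= t <= 1 -> Y^[t] <=o X^[t].
Proof.
move=> t01; have [c c0 h] := epow_le_approx.
apply: (@ople_lim _ _ _ _ (X^[t])); [|exact: epow_adj..].
move=> d d0; have c1 : 0 < c + 1 by lra.
have half : 0 <= (2^-1 : R) < 1 by lra.
have [n hn] := expr_small half (divr_gt0 d0 c1).
apply: ople_trans (h n t t01) _; rewrite scalerDl scale1r.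
apply: opleD (ople_refl _) _; apply: opleZl; last exact: epow_pos.
have := hn n (leqnn n); rewrite exprVn => h1.
apply: le_trans (ler_wpM2l c0 h1) _.
by rewrite mulrA ler_pdivrMr // mulrC ler_pM2l // lerDl.
Qed.

End LoewnerHeinzBounded.

(** * Powers of positive operators and the general Loewner-Heinz inequality *)

Section Powers.
Variables (R : realType) (H : qhilbertType R).
Implicit Types (S T X Y A B : bop H) (r s t p q a e d : R).
Local Notation "c %:O" := (c *: (1 : bop H)) (format "c %:O").

Definition pow T t : bop H := fc T (pw t).

Lemma rspectrum_ge0 T s : pos T -> rspectrum T s -> 0 <= s.
Proof.
move=> pT; have [M M0 TM] := bop_upper pT.1.
by move=> /(rspectrum_itv pT TM) /andP[].
Qed.

Lemma pow_pos T t : pos T -> 0 <= t -> pos (pow T t).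
Proof.
move=> pT t0; apply: fc_pos => // [|s _]; first exact: pw_continuous.
exact: pw_ge0.
Qed.

Lemma pow_adj T t : pos T -> 0 <= t -> adj (pow T t) (pow T t).
Proof. by move=> pT t0; case: (pow_pos pT t0). Qed.

Lemma pow1 T : pos T -> pow T 1 = T.
Proof.
move=> pT; rewrite -[RHS](fc_id pT); apply/esym/fc_ext => // [|s sT].
  exact: pw_continuous.
have s0 := rspectrum_ge0 pT sT.
by rewrite pwE // powRr1.
Qed.

Lemma pow0 T : pos T -> pow T 0 = 1.
Proof.
move=> pT; rewrite /pow; have -> : pw 0 = fun=> 1 :> R.
  by apply/funext => s; rewrite /pw powRr0.
by rewrite fc_cst // scale1r.
Qed.

Lemma powD T s t : pos T -> 0 <= s -> 0 <= t -> pow T (s + t) = pow T s * pow T t.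
Proof.
move=> pT s0 t0; rewrite -fcM //; [|exact: pw_continuous..].
by congr fc; apply/funext => x /=; rewrite /pw powRD_ge0.
Qed.

Lemma pow_pow T s t : pos T -> 0 <= s -> 0 <= t ->
  pow (pow T s) t = pow T (s * t).
Proof.
move=> pT s0 t0; have := @fc_comp _ _ T pT _ _ (pw_continuous t0) (pw_continuous s0).
rewrite -/(pow T s) -/(pow (pow T s) t) => -> => [|x _]; last exact: pw_ge0.
by congr fc; apply/funext => x; rewrite [LHS]pwE ?pw_ge0 // /pw powRrM.
Qed.

(** The spectrum lies in [0, +oo), where the clamped power is s^t; continuity of s^t within the
    spectrum is inherited from it. *)
Lemma op_pow_pow T t : pos T -> 0 <= t -> op_pow T t = pow T t.
Proof.
move=> pT t0; have sc : spectral_cont T (pw t).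
  by apply: continuous_spectral_cont; exact: pw_continuous.
have E s : s \in rspectrum T -> pw t s = powR s t.
  by rewrite inE => /(rspectrum_ge0 pT); exact: pwE.
have sc' : spectral_cont T (fun s => powR s t).
  by apply: subspace_eq_continuous sc => s sT; exact: E.
rewrite /op_pow (cfc_fc pT sc'); congr bop_fun.
apply: (fc_ext pT (pw_continuous t0)) => s sT.
by apply: E; rewrite inE.
Qed.

Lemma pos_shift T e : pos T -> 0 < e -> pos (T + e%:O).
Proof. by move=> pT e0; apply: pos_add => //; apply: pos_scale; [exact: ltW|exact: pos1]. Qed.

(** Shifting by e gives Y^t <= (Y + e)^t <= (X + e)^t <= X^t + e^t. *)
Theorem loewner_heinz X Y t : pos X -> pos Y -> Y <=o X -> 0 <= t <= 1 ->
  pow Y t <=o pow X t.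
Proof.
move=> pX pY YX /andP[t0 t1].
have [->|t_neq0] := eqVneq t 0; first by rewrite !pow0 //; exact: ople_refl.
have t_gt0 : 0 < t by rewrite lt_def t_neq0.
apply: (@ople_lim _ _ _ _ 1); [|exact: pow_adj..] => d d0.
(* Chosen so that e^t = d. *)
pose e := powR d t^-1; have e0 : 0 < e by exact: powR_gt0.
have shift Z : pos Z -> fc (Z + e%:O) (fun s => powR (Num.max e s) t) =
    fc Z (fun s => powR (Num.max e (s + e)) t).
  move=> pZ; have -> : Z + e%:O = fc Z (idfun \+ (fun=> e)).
    by rewrite fcD ?fc_id ?fc_cst // => x; [exact: cvg_id|exact: cst_continuous].
  rewrite fc_comp //.
  - exact: powR_max_continuous.
  - by move=> x; apply: continuousD; [exact: cvg_id|exact: cst_continuous].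
  - by move=> s /(rspectrum_ge0 pZ) s0 /=; rewrite addr_ge0 // ltW.
have cshift : continuous (fun s => powR (Num.max e (s + e)) t).
  move=> s; apply: (@continuous_comp _ _ _ (fun s => s + e)
    (fun s => powR (Num.max e s) t)); last exact: powR_max_continuous.
  by apply: continuousD; [exact: cvg_id|exact: cst_continuous].
have lower Z : pos Z -> e%:O <=o Z + e%:O by move=> pZ; rewrite /ople addrK.
have := epow_le e0 (pos_shift pX e0) (pos_shift pY e0) (lower X pX) (lower Y pY)
  (opleD YX (ople_refl _)) (t := t).
rewrite (shift X pX) (shift Y pY) => /(_ (introT andP (conj t0 t1))) h.
apply: ople_trans (ople_trans h _).
  apply: fc_le => // [|s /(rspectrum_ge0 pY) s0]; first exact: pw_continuous.
  rewrite pwE //; apply: powR_le => //.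
  by rewrite le_max lerDl (ltW e0) orbT.
have -> : pow X t + d%:O = fc X (pw t \+ (fun=> d)).
  by rewrite fcD ?fc_cst //; [exact: pw_continuous|exact: cst_continuous].
apply: fc_le => // [|s /(rspectrum_ge0 pX) s0].
  move=> s; apply: continuousD; [exact: pw_continuous|exact: cst_continuous].
rewrite /= pwE // max_r; last by rewrite lerDr.
have -> : d = powR e t by rewrite powR_root // ltW.
exact: powR_subadd.
Qed.

(** With u = <P' x, x> and v = <Q' x, x>, Cauchy-Schwarz for Q at P' x and Q' x gives u^2 <= <Q P'
    x, P' x> v <= u v. *)
Lemma inverse_antitone (P P' Q Q' : bop H) : pos P' -> pos Q -> pos Q' ->
  P * P' = 1 -> Q * Q' = 1 -> Q <=o P -> P' <=o Q'.
Proof.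
move=> pP' pQ pQ' PP QQ QP; apply: ople_adj; [exact: pP'.1|exact: pQ'.1|move=> x].
set u := rdot (P' x) x; set v := rdot (Q' x) x.
have u0 : 0 <= u := pP'.2 x; have v0 : 0 <= v := pQ'.2 x.
have h : u ^+ 2 <= u * v.
  have := pos_CauchySchwarz (P' x) (Q' x) pQ.
  rewrite pQ.1 -[Q (Q' x)]bopME QQ bop1E -/u => /le_trans; apply.
  have := opleE (P' x) QP; rewrite -[P (P' x)]bopME PP bop1E [rdot x _]rdotC -/u.
  by rewrite [rdot x _]rdotC -/v => k; apply: ler_wpM2r.
have [->//|un0] := eqVneq u 0.
have u_gt0 : 0 < u by rewrite lt_def un0.
by rewrite -(ler_pM2l u_gt0) -expr2.
Qed.

(* The operator antitone function replacing the singular [s^(-a)]. *)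
Definition damp a d s := (pw a s + d)^-1.

Lemma damp_denom_gt0 a d s : 0 < d -> 0 < pw a s + d.
Proof. by move=> d0; rewrite ltr_wpDl // pw_ge0. Qed.

Lemma damp_continuous a d : 0 <= a -> 0 < d -> continuous (damp a d).
Proof.
move=> a0 d0 s; apply: (@continuousV _ _ (pw a \+ (fun=> d)) s).
  by rewrite /= gt_eqF // damp_denom_gt0.
by apply: continuousD; [exact: pw_continuous|exact: cst_continuous].
Qed.

(** The damped operators are the inverses of X^a + d and Y^a + d, which Loewner-Heinz orders. *)
Lemma damp_antitone X Y a d : pos X -> pos Y -> Y <=o X -> 0 <= a <= 1 -> 0 < d ->
  fc X (damp a d) <=o fc Y (damp a d).
Proof.
move=> pX pY YX a01 d0; have /andP[a0 a1] := a01.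
have inv Z : pos Z -> (pow Z a + d%:O) * fc Z (damp a d) = 1.
  move=> pZ; have cs : continuous (pw a \+ (fun=> d)).
    by move=> s; apply: continuousD; [exact: pw_continuous|exact: cst_continuous].
  have -> : pow Z a + d%:O = fc Z (pw a \+ (fun=> d)).
    by rewrite fcD ?fc_cst //; [exact: pw_continuous|exact: cst_continuous].
  rewrite -fcM //; last exact: damp_continuous.
  have -> : (pw a \+ (fun=> d)) \* damp a d = fun=> 1.
    by apply/funext => s /=; rewrite divff // gt_eqF // damp_denom_gt0.
  by rewrite fc_cst // scale1r.
have dpos Z : pos Z -> pos (fc Z (damp a d)).
  move=> pZ; apply: fc_pos => // [|s _]; first exact: damp_continuous.
  by rewrite invr_ge0 ltW // damp_denom_gt0.
apply: (inverse_antitone _ _ _ (inv X pX) (inv Y pY)); [exact: dpos| |exact: dpos|].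
  by apply: pos_shift => //; exact: pow_pos.
apply: opleD (ople_refl _); exact: loewner_heinz.
Qed.

Lemma pow_half T t : pos T -> 0 <= t -> pow T (t / 2) * pow T (t / 2) = pow T t.
Proof. by move=> pT t0; rewrite -powD ?divr_ge0 // -splitr. Qed.

Lemma pow_sandwich T r s : pos T -> 0 <= r -> 0 <= s ->
  pow T r * pow T s * pow T r = pow T (s + 2 * r).
Proof.
move=> pT r0 s0; rewrite -!powD ?addr_ge0 //.
by congr pow; ring.
Qed.

Lemma sandwich_pos A B r p : pos A -> pos B -> 0 <= r -> 0 <= p ->
  pos (pow B r * pow A p * pow B r).
Proof.
by move=> pA pB r0 p0; apply: pos_conj; [exact: pow_adj | exact: pow_pos].
Qed.

(** Separates the limit s from the error that [damped_small] controls. *)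
Lemma damped_powE p s d : 1 <= p -> 0 <= s -> 0 < d ->
  powR s p / (powR s (p - 1) + d) = s - s * d / (powR s (p - 1) + d).
Proof.
move=> p1 s0 d0; rewrite -(@mulr_powRB1 _ s p) //; last by lra.
have n0 : powR s (p - 1) + d != 0 by rewrite gt_eqF // ltr_wpDl ?powR_ge0.
by field.
Qed.

Lemma damped_pow1E a s d : 0 <= a < 1 -> 0 <= s -> 0 < d ->
  s / (powR s a + d) = powR s (1 - a) - powR s (1 - a) * d / (powR s a + d).
Proof.
move=> /andP[a0 a1] s0 d0.
have -> : s / (powR s a + d) = powR s (1 - a) * powR s a / (powR s a + d).
  by rewrite -powRD ?subrK ?powRr1 // oner_eq0.
have n0 : powR s a + d != 0 by rewrite gt_eqF // ltr_wpDl ?powR_ge0.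
by field.
Qed.

(** * Furuta's inequality for r <= 1/2 at the extremal exponent *)

Section Base.
Variables (A B : bop H) (pA : pos A) (pB : pos B) (BA : B <=o A).
Variables (p r : R) (p1 : 1 <= p) (r0 : 0 <= r) (r2 : r <= 1 / 2).

(** Here q is the outer exponent itself, the reciprocal of the q of the inequality in the case of
    equality, and a = 1 - q. *)
Variables (a q : R).
Hypothesis (aE : a = (p - 1) / (p + 2 * r)) (qE : q = (1 + 2 * r) / (p + 2 * r)).

Let n0 : 0 < p + 2 * r. Proof. have [P1 R0 R2] := And3 p1 r0 r2; lra. Qed.
Let a01 : 0 <= a < 1.
Proof.
have [P1 R0 R2] := And3 p1 r0 r2.
by rewrite aE divr_ge0 ?subr_ge0 ?(ltW n0) //= ltr_pdivrMr // mul1r; lra. Qed.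
Let q0 : 0 < q. Proof. by have [P1 R0 R2] := And3 p1 r0 r2; rewrite qE divr_gt0 //; lra. Qed.
Let aq : 1 - a = q.
Proof. by rewrite aE qE; field; rewrite gt_eqF. Qed.

(** Since (p + 2r) a = p - 1, this is s^p / (s^(p-1) + d), a damped version of s. *)
Let g d s := pw (p / 2) s * damp a d (pw (p + 2 * r) s) * pw (p / 2) s.

Let gE d s : 0 < d -> 0 <= s -> g d s = powR s p / (powR s (p - 1) + d).
Proof.
have [P1 R0 R2] := And3 p1 r0 r2.
move=> d0 s0; rewrite /g /damp [pw a _]pwE ?pw_ge0 // !pwE // -powRrM.
have -> : (p + 2 * r) * a = p - 1 by rewrite aE mulrC divfK // gt_eqF.
rewrite mulrAC -powRD_ge0 -?splitr //; lra.
Qed.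

Let cg d : 0 < d -> continuous (g d).
Proof.
have [P1 R0 R2] := And3 p1 r0 r2.
move=> d0 s; have c2 : {for s, continuous (pw (p / 2))}.
  by apply: pw_continuous; rewrite divr_ge0 //; lra.
have cd : {for s, continuous (fun s => damp a d (pw (p + 2 * r) s))}.
  apply: (@continuous_comp _ _ _ (pw (p + 2 * r)) (damp a d)).
    exact/pw_continuous/ltW.
  by apply: damp_continuous => //; case/andP: a01.
exact: continuousM (continuousM c2 cd) c2.
Qed.

Let gM T d : pos T -> 0 < d -> fc T (g d) =
  pow T (p / 2) * fc (pow T (p + 2 * r)) (damp a d) * pow T (p / 2).
Proof.
have [P1 R0 R2] := And3 p1 r0 r2.
move=> pT d0; have c2 : continuous (pw (p / 2)).
  by apply: pw_continuous; rewrite divr_ge0 //; lra.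
have cn : continuous (pw (p + 2 * r)) by apply/pw_continuous/ltW.
have cd : continuous (damp a d) by apply: damp_continuous => //; case/andP: a01.
have cdn : continuous (fun s => damp a d (pw (p + 2 * r) s)).
  by move=> s; apply: (@continuous_comp _ _ _ (pw (p + 2 * r)) (damp a d)); [exact: cn|exact: cd].
rewrite {2}/pow fc_comp //; last by move=> s _; exact: pw_ge0.
rewrite -fcM // -fcM //.
by move=> s; apply: continuousM; [exact: c2|exact: cdn].
Qed.

Let swap (C D : bop H) d : adj C D -> 0 < d ->
  fc (D * C) (fun s => damp a d s * s) = D * fc (C * D) (damp a d) * C.
Proof.
by move=> h d0; apply: fc_swap => //; apply: damp_continuous => //; case/andP: a01.
Qed.

Let cdamp_id d : 0 < d -> continuous (fun s => damp a d s * s).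
Proof.
move=> d0 s; apply: continuousM; last exact: cvg_id.
by apply: damp_continuous => //; case/andP: a01.
Qed.

(** The chain is B^(1+2r) - e B^(2r) = B^r (B - e) B^r <= B^r (A - e) B^r <= B^r g(A) B^r = D
    damp(A^(p+2r)) C <= D damp(C D) C, and the last term is s damp(s) at D C, hence at most (D
    C)^q. *)
Lemma furuta_lower_base :
  pow B (1 + 2 * r) <=o pow (pow B r * pow A p * pow B r) q.
Proof.
have [P1 R0 R2] := And3 p1 r0 r2.
have r20 : 0 <= 2 * r by lra.
have p20 : 0 <= p / 2 by rewrite divr_ge0 //; lra.
have p0 : 0 <= p by lra.
have a0 : 0 <= a by case/andP: a01.
have [C CE] : exists C, C = pow A (p / 2) * pow B r by eexists.
have [D DE] : exists D, D = pow B r * pow A (p / 2) by eexists.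
have aCD : adj C D by rewrite CE DE; apply: adjM; exact: pow_adj.
have DC : D * C = pow B r * pow A p * pow B r.
  by rewrite DE CE bop_mulA4 pow_half.
(* The restriction r <= 1/2 enters here: B^(2r) <= A^(2r) is Loewner-Heinz with exponent 2r <= 1. *)
have CD : C * D <=o pow A (p + 2 * r).
  have -> : C * D = pow A (p / 2) * pow B (2 * r) * pow A (p / 2).
    have -> : 2 * r = r + r by ring.
    by rewrite DE CE bop_mulA4 powD.
  have -> : p + 2 * r = 2 * r + 2 * (p / 2) by field.
  rewrite -pow_sandwich //; apply: ople_conj; first exact: pow_adj.
  by apply: loewner_heinz => //; lra.
have pDC : pos (D * C) := pos_adjM aCD.
have pCD : pos (C * D) := pos_adjM (adjC aCD).
rewrite -DC; apply: (@ople_lim _ _ _ _ (pow B (2 * r))); last 2 first.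
- by apply: pow_adj => //; lra.
- exact/pow_adj/ltW.
move=> e e0; have [M M0 AM] := bop_upper pA.1.
have pm1 : 0 <= p - 1 by lra.
have [d d0 hd] := damped_small M0 pm1 e0.
rewrite -{1}[pow B (1 + 2 * r)](subrK (e *: pow B (2 * r))).
apply: opleD (ople_refl _).
apply: (@ople_trans _ _ (pow B r * fc A (g d) * pow B r)).
  have -> : pow B (1 + 2 * r) - e *: pow B (2 * r) =
      pow B r * (B - e%:O) * pow B r.
    have e1 : pow B r * B * pow B r = pow B (1 + 2 * r).
      by rewrite -{2}(pow1 pB) pow_sandwich.
    have e2 : pow B r * pow B r = pow B (2 * r).
      by rewrite -powD //; congr pow; ring.
    by rewrite bop_conj_shift e1 e2.
  apply: ople_conj; first exact: pow_adj.
  apply: (@ople_trans _ _ (A - e%:O)).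
    by apply: opleD => //; exact: ople_refl.
  have -> : A - e%:O = fc A (idfun \+ (fun=> - e)).
    rewrite fcD ?fc_id ?fc_cst ?scaleNr // => x; first exact: cvg_id.
    exact: cst_continuous.
  apply: fc_le => //.
  - by move=> x; apply: continuousD; [exact: cvg_id|exact: cst_continuous].
  - exact: cg.
  move=> s sA; have /andP[s0 sM] := rspectrum_itv pA AM sA.
  rewrite gE // damped_powE //= lerD2l lerN2; apply: hd; exact/andP.
apply: (@ople_trans _ _ (fc (D * C) (fun s => damp a d s * s))).
  rewrite swap // gM //.
  have -> : pow B r * (pow A (p / 2) * fc (pow A (p + 2 * r)) (damp a d) *
      pow A (p / 2)) * pow B r = D * fc (pow A (p + 2 * r)) (damp a d) * C.
    by rewrite DE CE; exact/esym/bop_mulA5.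
  apply: (ople_conj aCD); apply: damp_antitone => //; first exact/pow_pos/ltW.
  by case/andP: a01 => -> /ltW.
apply: fc_le => //; [exact: cdamp_id|exact/pw_continuous/ltW|].
move=> s /(rspectrum_ge0 pDC) s0; rewrite /damp !pwE // mulrC damped_pow1E //.
rewrite aq gerDl oppr_le0 divr_ge0 ?mulr_ge0 ?powR_ge0 ?(ltW d0) //.
by rewrite addr_ge0 ?powR_ge0 // ltW.
Qed.

(** The chain runs the other way: (D C)^q <= D damp(C D) C + e <= D damp(B^(p+2r)) C + e = A^r g(B)
    A^r + e <= A^r B A^r + e <= A^(1+2r) + e. *)
Lemma furuta_upper_base :
  pow (pow A r * pow B p * pow A r) q <=o pow A (1 + 2 * r).
Proof.
have [P1 R0 R2] := And3 p1 r0 r2.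
have r20 : 0 <= 2 * r by lra.
have p20 : 0 <= p / 2 by rewrite divr_ge0 //; lra.
have p0 : 0 <= p by lra.
have /andP[a0 a1] := a01.
have [C CE] : exists C, C = pow B (p / 2) * pow A r by eexists.
have [D DE] : exists D, D = pow A r * pow B (p / 2) by eexists.
have aCD : adj C D by rewrite CE DE; apply: adjM; exact: pow_adj.
have DC : D * C = pow A r * pow B p * pow A r.
  by rewrite DE CE bop_mulA4 pow_half.
have CD : pow B (p + 2 * r) <=o C * D.
  have -> : C * D = pow B (p / 2) * pow A (2 * r) * pow B (p / 2).
    have -> : 2 * r = r + r by ring.
    by rewrite DE CE bop_mulA4 powD.
  have -> : p + 2 * r = 2 * r + 2 * (p / 2) by field.
  rewrite -pow_sandwich //; apply: ople_conj; first exact: pow_adj.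
  by apply: loewner_heinz => //; lra.
have pDC : pos (D * C) := pos_adjM aCD.
have pCD : pos (C * D) := pos_adjM (adjC aCD).
rewrite -DC; apply: (@ople_lim _ _ _ _ 1); last 2 first.
- exact/pow_adj/ltW.
- by apply: pow_adj => //; lra.
move=> e e0; have [M M0 DCM] := bop_upper pDC.1.
have M'0 : 0 < powR M q by exact: powR_gt0.
(* The damping error is now incurred at D C. With y = s^q one has s^a = y^(a/q) and y <= M^q. *)
have [d d0 hd] := damped_small M'0 (divr_ge0 a0 (ltW q0)) e0.
apply: (@ople_trans _ _ (fc (D * C) ((fun s => damp a d s * s) \+ (fun=> e)))).
  apply: fc_le => //; first exact/pw_continuous/ltW.
    by move=> s; apply: continuousD; [exact: cdamp_id|exact: cst_continuous].
  move=> s sDC; have /andP[s0 sM] := rspectrum_itv pDC DCM sDC.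
  rewrite /= /damp !pwE // [_^-1 * _]mulrC damped_pow1E // aq.
  have qa : q * (a / q) = a by rewrite mulrC divfK // gt_eqF.
  have := hd (powR s q); rewrite -powRrM qa => h.
  rewrite -addrA lerDl addrC subr_ge0; apply: h.
  by rewrite powR_ge0 /= powR_le // ltW.
rewrite fcD ?fc_cst //; [|exact: cdamp_id|exact: cst_continuous].
apply: opleD (ople_refl _).
rewrite swap //; apply: (@ople_trans _ _ (pow A r * fc B (g d) * pow A r)).
  rewrite gM //.
  have -> : pow A r * (pow B (p / 2) * fc (pow B (p + 2 * r)) (damp a d) *
      pow B (p / 2)) * pow A r = D * fc (pow B (p + 2 * r)) (damp a d) * C.
    by rewrite DE CE; exact/esym/bop_mulA5.
  apply: (ople_conj aCD); apply: damp_antitone => //; first exact/pow_pos/ltW.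
  by rewrite a0 ltW.
rewrite -pow_sandwich // pow1 //; apply: ople_conj; first exact: pow_adj.
apply: ople_trans BA; rewrite -[X in _ <=o X](fc_id pB); apply: fc_le => //.
- exact: cg.
- by move=> x; exact: cvg_id.
move=> s /(rspectrum_ge0 pB) s0; rewrite gE // damped_powE //= gerDl oppr_le0.
rewrite divr_ge0 ?mulr_ge0 ?(ltW d0) //.
by rewrite addr_ge0 ?powR_ge0 // ltW.
Qed.

End Base.

End Powers.

(** * Furuta's inequality *)

Section Furuta.
Variables (R : realType) (H : qhilbertType R).
Implicit Types (T X Y A B : bop H) (r s p q : R).

(* From [A1 = (B^s A^p B^s)^(1/q1) >= B^(1+2s) = B1], the case [r = 1/2] for
   (A1, B1, q1) gives the case [1 + 2r = 2 (1 + 2s)] for (A, B, p). *)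
Lemma furuta_doubling A B p r s : pos A -> pos B -> 1 <= p -> 0 <= s ->
  1 + 2 * r = 2 * (1 + 2 * s) ->
  pow (pow B (1 + 2 * s)) (1 / 2) *
    pow (pow (pow B s * pow A p * pow B s) ((1 + 2 * s) / (p + 2 * s)))
      ((p + 2 * s) / (1 + 2 * s)) *
    pow (pow B (1 + 2 * s)) (1 / 2) = pow B r * pow A p * pow B r.
Proof.
move=> pA pB p1 s0 rs; have s1 : 0 < 1 + 2 * s by lra.
have ps : 0 < p + 2 * s by lra.
have pX : pos (pow B s * pow A p * pow B s) by apply: sandwich_pos => //; lra.
rewrite !pow_pow ?divr_ge0 ?(ltW s1) ?(ltW ps) //.
have -> : (1 + 2 * s) / (p + 2 * s) * ((p + 2 * s) / (1 + 2 * s)) = 1.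
  by field; rewrite !gt_eqF.
have -> : (1 + 2 * s) * (1 / 2) = 1 / 2 + s by field.
(* B1^(1/2) B^s = B^(1/2 + 2s) = B^r, and the outer power q1 of A1 restores B^s A^p B^s. *)
have rE : r = 1 / 2 + s + s by lra.
have h : 0 <= 1 / 2 + s by lra.
have e1 : pow B r = pow B (1 / 2 + s) * pow B s by rewrite rE powD.
have e2 : pow B r = pow B s * pow B (1 / 2 + s) by rewrite rE addrC powD.
by rewrite (pow1 pX) {1}e1 e2; exact/esym/bop_mulA5.
Qed.

(** Induction on n with 1 + 2r <= 2^(n+1): n = 0 means r <= 1/2, and each step halves 1 + 2r. *)
Lemma furuta_lower A B p r : pos A -> pos B -> B <=o A -> 1 <= p -> 0 <= r ->
  pow B (1 + 2 * r) <=o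
  pow (pow B r * pow A p * pow B r) ((1 + 2 * r) / (p + 2 * r)).
Proof.
move=> pA pB BA p1 r0.
have [n hn] : exists n, 1 + 2 * r <= 2 ^+ n.+1.
  exists (Num.truncn (1 + 2 * r)); apply: le_trans (ltW (truncnS_gt _)) _.
  by rewrite -natrX ler_nat ltnW // ltn_expl.
elim: n r r0 hn => [|n IH] r r0 hn.
  by apply: (@furuta_lower_base _ _ A B _ _ _ p r _ _ _ ((p - 1) / (p + 2 * r)));
    rewrite // expr1 in hn *; lra.
have [r2|r2] := leP r (1 / 2).
  by apply: (@furuta_lower_base _ _ A B _ _ _ p r _ _ _ ((p - 1) / (p + 2 * r))).
(* The solution of 1 + 2r = 2 (1 + 2s); it is nonnegative because r > 1/2. *)
pose s := (2 * r - 1) / 4; have s0 : 0 <= s by rewrite /s; lra.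
have rs : 1 + 2 * r = 2 * (1 + 2 * s) by rewrite /s; lra.
have s1 : 0 < 1 + 2 * s by lra.
have ps : 0 < p + 2 * s by lra.
have hs : 1 + 2 * s <= 2 ^+ n.+1.
  by move: hn; rewrite rs exprS ler_pM2l.
have := furuta_doubling pA pB p1 s0 rs.
set A1 := pow _ ((1 + 2 * s) / _); set B1 := pow B (1 + 2 * s).
set q := (p + 2 * s) / (1 + 2 * s) => E.
have p0 : 0 <= p := le_trans ler01 p1.
have pA1 : pos A1.
  exact: pow_pos (sandwich_pos pA pB s0 p0) (divr_ge0 (ltW s1) (ltW ps)).
have pB1 : pos B1 := pow_pos pB (ltW s1).
have q1 : 1 <= q by rewrite ler_pdivlMr // mul1r; lra.
have := furuta_lower_base pA1 pB1 (IH s s0 hs) q1 (_ : 0 <= 1 / 2) (lexx (1 / 2))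
  erefl erefl.
rewrite E /B1 pow_pow; [|by []|exact: ltW|lra].
have -> : (1 + 2 * s) * (1 + 2 * (1 / 2)) = 1 + 2 * r by lra.
(* The exponent 2 / (q + 1) with q = (p + 2s)/(1 + 2s) is the required one, as p + 2r = p + 1 +
   4s. *)
have -> : (1 + 2 * (1 / 2)) / (q + 2 * (1 / 2)) = (1 + 2 * r) / (p + 2 * r).
  have -> : r = 2 * s + 1 / 2 by lra.
  by rewrite /q; field; rewrite !gt_eqF //=; lra.
by apply; lra.
Qed.

(** The same induction with the doubling identity for A and B exchanged: the hypothesis at s reads
    B1 <= A1 = A^(1+2s). *)
Lemma furuta_upper A B p r : pos A -> pos B -> B <=o A -> 1 <= p -> 0 <= r ->
  pow (pow A r * pow B p * pow A r) ((1 + 2 * r) / (p + 2 * r)) <=o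
  pow A (1 + 2 * r).
Proof.
move=> pA pB BA p1 r0.
have [n hn] : exists n, 1 + 2 * r <= 2 ^+ n.+1.
  exists (Num.truncn (1 + 2 * r)); apply: le_trans (ltW (truncnS_gt _)) _.
  by rewrite -natrX ler_nat ltnW // ltn_expl.
elim: n r r0 hn => [|n IH] r r0 hn.
  by apply: (@furuta_upper_base _ _ A B _ _ _ p r _ _ _ ((p - 1) / (p + 2 * r)));
    rewrite // expr1 in hn *; lra.
have [r2|r2] := leP r (1 / 2).
  by apply: (@furuta_upper_base _ _ A B _ _ _ p r _ _ _ ((p - 1) / (p + 2 * r))).
pose s := (2 * r - 1) / 4; have s0 : 0 <= s by rewrite /s; lra.
have rs : 1 + 2 * r = 2 * (1 + 2 * s) by rewrite /s; lra.
have s1 : 0 < 1 + 2 * s by lra.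
have ps : 0 < p + 2 * s by lra.
have hs : 1 + 2 * s <= 2 ^+ n.+1.
  by move: hn; rewrite rs exprS ler_pM2l.
have := furuta_doubling pB pA p1 s0 rs.
set B1 := pow _ ((1 + 2 * s) / _); set A1 := pow A (1 + 2 * s).
set q := (p + 2 * s) / (1 + 2 * s) => E.
have p0 : 0 <= p := le_trans ler01 p1.
have pB1 : pos B1.
  exact: pow_pos (sandwich_pos pB pA s0 p0) (divr_ge0 (ltW s1) (ltW ps)).
have pA1 : pos A1 := pow_pos pA (ltW s1).
have q1 : 1 <= q by rewrite ler_pdivlMr // mul1r; lra.
have := furuta_upper_base pA1 pB1 (IH s s0 hs) q1 (_ : 0 <= 1 / 2) (lexx (1 / 2))
  erefl erefl.
rewrite E /A1 pow_pow; [|by []|exact: ltW|lra].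
have -> : (1 + 2 * s) * (1 + 2 * (1 / 2)) = 1 + 2 * r by lra.
have -> : (1 + 2 * (1 / 2)) / (q + 2 * (1 / 2)) = (1 + 2 * r) / (p + 2 * r).
  have -> : r = 2 * s + 1 / 2 by lra.
  by rewrite /q; field; rewrite !gt_eqF //=; lra.
by apply; lra.
Qed.

Theorem furuta_pow A B r p q : pos A -> pos B -> B <=o A ->
  0 <= r -> 0 <= p -> 1 <= q -> p + 2 * r <= (1 + 2 * r) * q ->
  pow B ((p + 2 * r) / q) <=o pow (pow B r * pow A p * pow B r) (1 / q) /\
  pow (pow A r * pow B p * pow A r) (1 / q) <=o pow A ((p + 2 * r) / q).
Proof.
move=> pA pB BA r0 p0 q1 hq; have q0 : 0 < q by lra.
have pr0 : 0 <= p + 2 * r by lra.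
have iq : 0 <= 1 / q <= 1 by rewrite divr_ge0 ?(ltW q0) //= ler_pdivrMr // mul1r.
have pX : pos (pow B r * pow A p * pow B r) by apply: sandwich_pos.
have pY : pos (pow A r * pow B p * pow A r) by apply: sandwich_pos.
have [p1|p1] := leP p 1.
  have AB : pow B p <=o pow A p by apply: loewner_heinz => //; rewrite p0.
  (* For p <= 1 the pure power is itself a sandwich T^r T^p T^r, so conjugating B^p <= A^p compares
     it with the mixed one. *)
  have e T : pos T ->
      pow T ((p + 2 * r) / q) = pow (pow T r * pow T p * pow T r) (1 / q).
    move=> pT; rewrite (pow_sandwich pT r0 p0) (pow_pow pT pr0 _) ?mul1r //.
    by case/andP: iq; rewrite mul1r.
  have c1 := ople_conj (pow_adj pB r0) AB; have c2 := ople_conj (pow_adj pA r0) AB.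
  rewrite (e A pA) (e B pB).
  split.
    exact: (loewner_heinz pX (sandwich_pos pB pB r0 p0) c1 iq).
  exact: (loewner_heinz (sandwich_pos pA pA r0 p0) pY c2 iq).
have r1 : 0 < 1 + 2 * r by lra.
have pr : 0 < p + 2 * r by lra.
(* Raising to the power t turns the exponent (1 + 2r)/(p + 2r) into 1/q; the condition on p, q and r
   says exactly that t <= 1. *)
pose t := (p + 2 * r) / (1 + 2 * r) / q.
have t01 : 0 <= t <= 1.
  rewrite !divr_ge0 ?(ltW r1) ?(ltW q0) //= ler_pdivrMr // mul1r.
  by rewrite ler_pdivrMr // [q * _]mulrC.
have t0 : 0 <= t by case/andP: t01.
have d0 : 0 <= (1 + 2 * r) / (p + 2 * r) by rewrite divr_ge0 // ltW.
have e1 : (1 + 2 * r) * t = (p + 2 * r) / q by rewrite /t; field; rewrite !gt_eqF.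
have e2 : (1 + 2 * r) / (p + 2 * r) * t = 1 / q by rewrite /t; field; rewrite !gt_eqF.
rewrite -e1 -e2 -(pow_pow pB (ltW r1) t0) -(pow_pow pA (ltW r1) t0).
rewrite -(pow_pow pX d0 t0) -(pow_pow pY d0 t0).
split.
  exact: (loewner_heinz (pow_pos pX d0) (pow_pos pB (ltW r1))
    (furuta_lower pA pB BA (ltW p1) r0) t01).
exact: (loewner_heinz (pow_pos pA (ltW r1)) (pow_pos pY d0)
  (furuta_upper pA pB BA (ltW p1) r0) t01).
Qed.

Lemma qi_mul_i (x : quat R) : qi (x * Quat 0 1 0 0) = qre x.
Proof. by case: x => a b c d /=; ring. Qed.

(** Polarization: reality of <T (u + v), u + v> equates the i-components of <T u, v> and <u, T v>.
    Replacing v by v i turns these into real parts. *)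
Lemma op_ge0_pos T : op_ge0 T -> pos T.
Proof.
move=> h; split=> [x y|x]; last first.
  by have [a a0 E] := h x; rewrite /rdot E.
have im0 z : qi (qdot (T z) z) = 0 by have [a _ ->] := h z.
have im_sym u v : qi (qdot (T u) v) = qi (qdot u (T v)).
  have := im0 (u + v); rewrite bopD qdotDr.
  have expand w : qdot (T u + T v) w = qdot (T u) w + qdot (T v) w.
    rewrite -[LHS]conj_qdot qdotDr -[qdot (T u) w]conj_qdot -[qdot (T v) w]conj_qdot.
    by congr Quat; rewrite /= ?opprD.
  rewrite !expand /= !im0 add0r addr0 -[qdot u (T v)]conj_qdot /= => E.
  by apply/eqP; rewrite -subr_eq0 opprK addrC E.
by rewrite /rdot -!qi_mul_i -!qdotZr -bopZ im_sym.
Qed.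

(** Symmetry at x and x v gives Re(<T x, x> v) = Re(conj(<T x, x>) v); taking v = i, j, k shows that
    the imaginary components vanish. *)
Lemma pos_op_ge0 T : pos T -> op_ge0 T.
Proof.
move=> [aT pT] x; exists (rdot (T x) x); first exact: pT.
have re_mul (v : quat R) : qre (qdot (T x) x * v) = qre (qdot x (T x) * v).
  rewrite -!qdotZr -/(rdot _ _) aT bopZ.
  by [].
move: (re_mul (Quat 0 1 0 0)) (re_mul (Quat 0 0 1 0)) (re_mul (Quat 0 0 0 1)).
rewrite -[qdot x (T x)]conj_qdot /rdot; case: (qdot (T x) x) => a b c d /=.
rewrite !mulr0 !mulr1 !subr0 ?sub0r ?add0r !opprK => h1 h2 h3.
by congr Quat; lra.
Qed.

End Furuta.

Theorem theorem11 (R : realType) (H : qhilbertType R) (A B : H -> H)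
  (hA : bounded_op A) (hB : bounded_op B)
  (hBA : op_le B A) (hB0 : op_ge0 B)
  (r p q : R) (hr : 0 <= r) (hp : 0 <= p) (hq : 1 <= q)
  (hrpq : p + 2 * r <= (1 + 2 * r) * q) :
  op_le (B `^^ ((p + 2 * r) / q))
        ((B `^^ r \o A `^^ p \o B `^^ r) `^^ (1 / q)) /\
  op_le ((A `^^ r \o B `^^ p \o A `^^ r) `^^ (1 / q))
        (A `^^ ((p + 2 * r) / q)).
Proof.
have pB : pos (Bop hB) by exact: op_ge0_pos.
have BA : Bop hB <=o Bop hA by exact: op_ge0_pos.
have pA : pos (Bop hA).
  by rewrite -[Bop hA](subrK (Bop hB)); apply: pos_add.
have q0 : 0 < q by exact: lt_le_trans hq.
have pr0 : 0 <= p + 2 * r by rewrite addr_ge0 ?mulr_ge0.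
have [lower upper] := furuta_pow pA pB BA hr hp hq hrpq.
have pX := sandwich_pos pA pB hr hp; have pY := sandwich_pos pB pA hr hp.
have eA t : 0 <= t -> A `^^ t = pow (Bop hA) t by exact: (@op_pow_pow _ _ (Bop hA)).
have eB t : 0 <= t -> B `^^ t = pow (Bop hB) t by exact: (@op_pow_pow _ _ (Bop hB)).
have iq0 : 0 <= 1 / q by rewrite divr_ge0 // ltW.
have n0 : 0 <= (p + 2 * r) / q by rewrite divr_ge0 // ltW.
(* Composition of the underlying functions is by definition the product in [bop H], so the outer
   power is again that of a positive bundled operator. *)
have eX : (pow (Bop hB) r \o pow (Bop hA) p \o pow (Bop hB) r) `^^ (1 / q) =
  pow (pow (Bop hB) r * pow (Bop hA) p * pow (Bop hB) r) (1 / q).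
  exact: op_pow_pow pX iq0.
have eY : (pow (Bop hA) r \o pow (Bop hB) p \o pow (Bop hA) r) `^^ (1 / q) =
  pow (pow (Bop hA) r * pow (Bop hB) p * pow (Bop hA) r) (1 / q).
  exact: op_pow_pow pY iq0.
rewrite (eA _ hr) (eA _ hp) (eB _ hr) (eB _ hp) (eA _ n0) (eB _ n0) eX eY.
by split; [exact: pos_op_ge0 lower | exact: pos_op_ge0 upper].
Qed.
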